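(* Let $\tilde\rho:M\to S^3$ be a minimal immersion of a torus. Then $nnt(M)\le 5$ if and only if $M$ is one of the examples of Hsiang and Lawson, i.e. if and only if $\tilde\rho(M)$ is invariant under a nontrivial one-parameter group $\{e^{tB}:t\in\mathbb{R}\}$, $0\neq B\in so(4)$, of isometries of $S^3$.
   Context: $M$ is an oriented compact surface without boundary diffeomorphic to a torus, $\tilde\rho:M\to S^3\subset\mathbb{R}^4$ is a minimal immersion, and $M$ has the induced metric. $N:M\to S^3$ is a Gauss map: $N(m)\perp d\tilde\rho_m(T_mM)$ and $\langle N(m),\tilde\rho(m)\rangle=0$. $a:M\to\mathbb{R}$ is the nonnegative principal curvature function; for a torus $a$ is everywhere positive (Lawson) and smooth, and $W_1,W_2$ are fixed smooth unit tangent vector fields on $M$ with $dN(W_1)=-aW_1$, $dN(W_2)=aW_2$. $so(4)$ is the space of real skew-symmetric $4\times4$ matrices. For $B\in so(4)$, $f_B(m)=\langle B\tilde\rho(m),N(m)\rangle$. For $\theta\in\mathbb{R}$, $h_\theta=\cos(\theta)a^{-3/2}W_1(a)+\sin(\theta)a^{-3/2}W_2(a)$. The natural nullity is $nnt(M)=\dim NS$, where $NS=\{f_B+\lambda h_\theta: B\in so(4),\ \lambda,\theta\in\mathbb{R}\}$, a linear subspace of $C^\infty(M)$. The (toral) examples of Hsiang and Lawson are exactly the immersed minimal tori in $S^3$ that are preserved by a (nontrivial) one-parameter group of isometries of $S^3$. *)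

(* Defs.v *)
From HB Require Import structures.
From mathcomp Require Import all_boot all_order all_algebra.
From mathcomp Require Import all_classical all_reals all_analysis.
Import Order.TTheory GRing.Theory Num.Theory.
Import numFieldNormedType.Exports.

Set Implicit Arguments.
Unset Strict Implicit.
Unset Printing Implicit Defensive.

Local Open Scope classical_set_scope.
Local Open Scope ring_scope.

(* A torus M is given by a diffeomorphism M = R^2/Z^2, so a map on M is a
   Z^2-periodic map on the plane 'rV[R]_2 and every tangent space of M is
   identified with 'rV[R]_2. The metric of M is the one induced by the
   immersion; the flat metric of the plane plays no role. R^4 is 'cV[R]_4. *)

Section Calculus.
Context {R : realType} {V W : normedModType R}.

Fixpoint Ck (k : nat) (f : V -> W) : Prop :=
  if k is k'.+1 then
    (forall x, differentiable f x) /\ (forall v, Ck k' (fun x => 'D_v f x))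
  else continuous f.

Definition smooth (f : V -> W) := forall k, Ck k f.

End Calculus.

Section LinearAlgebra.
Context {R : realType}.

Definition dot (n : nat) (u v : 'cV[R]_n) : R := (u^T *m v) 0 0.

Definition skew_mx (n : nat) (B : 'M[R]_n) := B^T = - B.

Definition expmx (n : nat) (A : 'M[R]_n.+1) : 'M[R]_n.+1 :=
  limn (series (fun k => (k`!%:R)^-1 *: A ^+ k)).

Definition lin_indep (V : lmodType R) (n : nat) (b : 'I_n -> V) :=
  forall c : 'I_n -> R, \sum_i c i *: b i = 0 -> forall i, c i = 0.

(* the dimension, as the supremum of the sizes of linearly independent
   families, of a linear subspace S of a possibly infinite-dimensional space *)
Definition lin_dim (V : lmodType R) (S : set V) : \bar R :=
  ereal_sup [set (n%:R)%:E | n in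
    [set n : nat | exists b : 'I_n -> V, lin_indep b /\ forall i, S (b i)]].

End LinearAlgebra.

Section MinimalTori.
Context {R : realType}.
Implicit Types (rho N : 'rV[R]_2 -> 'cV[R]_4) (a : 'rV[R]_2 -> R)
  (W : 'rV[R]_2 -> 'rV[R]_2).

Definition torus_map T (f : 'rV[R]_2 -> T) :=
  forall x (k : 'rV[int]_2), f (x + map_mx intr k) = f x.

Definition immersion_S3 rho :=
  [/\ smooth rho, torus_map rho,
      forall m, dot (rho m) (rho m) = 1 &
      forall m, injective ('d rho m)].

Definition gauss_map rho N :=
  [/\ smooth N, torus_map N,
      forall m, dot (N m) (N m) = 1,
      forall m, dot (N m) (rho m) = 0 &
      forall m w, dot (N m) ('d rho m w) = 0].

Definition first_form rho (m : 'rV[R]_2) : 'M[R]_2 :=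
  \matrix_(i, j) dot ('d rho m (delta_mx 0 i)) ('d rho m (delta_mx 0 j)).

Definition second_form rho N (m : 'rV[R]_2) : 'M[R]_2 :=
  \matrix_(i, j) - dot ('d N m (delta_mx 0 i)) ('d rho m (delta_mx 0 j)).

Definition mean_curvature rho N (m : 'rV[R]_2) : R :=
  2^-1 * \tr (invmx (first_form rho m) *m second_form rho N m).

Definition minimal_immersion rho N :=
  [/\ immersion_S3 rho, gauss_map rho N &
      forall m, mean_curvature rho N m = 0].

(* k is an eigenvalue of the shape operator - dN *)
Definition principal_curvature rho N (m : 'rV[R]_2) (k : R) :=
  exists2 w : 'rV[R]_2, w != 0 & 'd N m w = - k *: 'd rho m w.

Definition nonneg_principal_curvature rho N a :=
  forall m, 0 <= a m /\ principal_curvature rho N m (a m).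

(* tangent vectors w are identified with 'd rho m w in R^4 *)
Definition unit_field rho W :=
  [/\ smooth W, torus_map W &
      forall m, dot ('d rho m (W m)) ('d rho m (W m)) = 1].

Definition principal_frame rho N a W1 W2 :=
  [/\ unit_field rho W1, unit_field rho W2,
      forall m, 'd N m (W1 m) = - a m *: 'd rho m (W1 m) &
      forall m, 'd N m (W2 m) = a m *: 'd rho m (W2 m)].

Definition fB rho N (B : 'M[R]_4) (m : 'rV[R]_2) : R :=
  dot (B *m rho m) (N m).

(* Principal frames on a minimal torus exist and force a to be smooth and
   everywhere positive, so the convention 0 `^ x = 0 (x != 0) is never used. *)
Definition htheta a W1 W2 (theta : R) (m : 'rV[R]_2) : R :=
  cos theta * a m `^ (- (3 / 2)) * 'D_(W1 m) a m +
  sin theta * a m `^ (- (3 / 2)) * 'D_(W2 m) a m.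

Definition NS rho N a W1 W2 : set ('rV[R]_2 -> R) :=
  [set g | exists (B : 'M[R]_4) (lambda theta : R), skew_mx B /\
     g = (fun m => fB rho N B m + lambda * htheta a W1 W2 theta m)].

Definition nnt rho N a W1 W2 : \bar R := lin_dim (NS rho N a W1 W2).

Definition hsiang_lawson rho :=
  exists B : 'M[R]_4, [/\ skew_mx B, B != 0 &
    forall t : R, [set expmx (t *: B) *m x | x in range rho] = range rho].

End MinimalTori.

(* Main.v *)
Require Import Defs.
From HB Require Import structures.
From mathcomp Require Import all_boot all_order all_algebra.
From mathcomp Require Import all_classical all_reals all_analysis.
From mathcomp Require Import ring lra.
Import Order.TTheory GRing.Theory Num.Theory.
Import numFieldNormedType.Exports.
Local Open Scope classical_set_scope.
Local Open Scope ring_scope.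

(** Write [f_B = <B rho, N>] for [B] in [so(4)]; it is the normal component of
    the Killing field [x |-> B x] along the surface. Both implications go
    through the existence of some [B <> 0] with [f_B = 0], that is of a Killing
    field of the sphere tangent to the surface.

    If the nullity is at most five, the six functions [f_B] attached to a basis
    of [so(4)] are linearly dependent, so [f_B = 0] for some [B <> 0]
    ([nnt_le5_fB_eq0]). The flow of a tangent Killing field preserves the
    surface: for [x] on the surface, the maximum over [m] of
    [<e^{tB} x, rho m>] equals one at [t = 0] and is stationary in [t], because
    at a maximiser [m] the tangent vector [B (rho m)] is orthogonal to
    [e^{tB} x]. Hence it is always one, and [e^{tB} x] stays in the range of
    [rho] ([flow_preserves_range]).

    Conversely, let every [e^{tB}] preserve the range of [rho]. If [f_B] were
    nonzero at some point, [(t, x) |-> e^{tB} (rho x)] would be an immersion of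
    a three-dimensional box into the range, which has box dimension at most
    two; a pigeonhole count excludes this ([invariant_range_fB_eq0]). Hence
    [f_B = 0].
    Let [e1], [e2] be the images of the principal frame, [v_i = <B rho, e_i>]
    and [r = <B e1, e2>]. The structure equations of the frame, together with
    the constancy of [B], give [p v2 = q v1] and [r = p v1 + q v2], where [p],
    [q] are the connection coefficients, and [W1(a) = - 2 a q],
    [W2(a) = 2 a p] by Codazzi ([structure_equations], [killing_equations]).
    It follows that [a (v1^2 + v2^2)] is constant, which leaves two cases
    ([a_gt0_or_eq0]): either [a = 0] identically, and every [h_theta] is zero,
    or [a > 0] everywhere. In the second case [sqrt a v1] and [sqrt a v2] are
    constant, so every [h_theta] is a constant multiple of [r]. Finally [r] is
    itself a function [f_B1], with [B1] the Hodge dual of [B]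
    ([dual_const], [fB_dual], [htheta_eq_fB]). Hence [NS] is the image of
    [so(4)] under [B |-> f_B], a map with a nonzero kernel, and its dimension is
    at most five ([nnt_le5]). *)

Set Implicit Arguments.
Unset Strict Implicit.
Unset Printing Implicit Defensive.

(** * Inner products and orthonormal bases *)

Section Dot.
Context {R : realType}.

Lemma dotE n (u v : 'cV[R]_n) : dot u v = \sum_i u i 0 * v i 0.
Proof. by rewrite /dot mxE; apply: eq_bigr => i _; rewrite mxE. Qed.

Lemma dotC n (u v : 'cV[R]_n) : dot u v = dot v u.
Proof. by rewrite !dotE; apply: eq_bigr => i _; rewrite mulrC. Qed.

Lemma dotDl n (u v w : 'cV[R]_n) : dot (u + v) w = dot u w + dot v w.
Proof. by rewrite /dot linearD mulmxDl mxE. Qed.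

Lemma dotDr n (u v w : 'cV[R]_n) : dot w (u + v) = dot w u + dot w v.
Proof. by rewrite /dot mulmxDr mxE. Qed.

Lemma dotZl n (k : R) (u v : 'cV[R]_n) : dot (k *: u) v = k * dot u v.
Proof. by rewrite /dot linearZ -scalemxAl mxE. Qed.

Lemma dotZr n (k : R) (u v : 'cV[R]_n) : dot u (k *: v) = k * dot u v.
Proof. by rewrite /dot -scalemxAr mxE. Qed.

Lemma dotNl n (u v : 'cV[R]_n) : dot (- u) v = - dot u v.
Proof. by rewrite -scaleN1r dotZl mulN1r. Qed.

Lemma dotNr n (u v : 'cV[R]_n) : dot u (- v) = - dot u v.
Proof. by rewrite -scaleN1r dotZr mulN1r. Qed.

Lemma dotBl n (u v w : 'cV[R]_n) : dot (u - v) w = dot u w - dot v w.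
Proof. by rewrite dotDl dotNl. Qed.

Lemma dotBr n (u v w : 'cV[R]_n) : dot w (u - v) = dot w u - dot w v.
Proof. by rewrite dotDr dotNr. Qed.

Lemma dot0l n (u : 'cV[R]_n) : dot 0 u = 0.
Proof. by rewrite -(scale0r 0) dotZl mul0r. Qed.

Lemma dot0r n (u : 'cV[R]_n) : dot u 0 = 0.
Proof. by rewrite dotC dot0l. Qed.

Definition dot_lin := (dotDl, dotDr, dotBl, dotBr, dotNl, dotNr, dotZl, dotZr,
  dot0l, dot0r).

Lemma dot_mulmxl n (A : 'M[R]_n) (u v : 'cV[R]_n) :
  dot (A *m u) v = dot u (A^T *m v).
Proof. by rewrite /dot trmx_mul mulmxA. Qed.

Lemma dot_skew n (B : 'M[R]_n) (u v : 'cV[R]_n) :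
  skew_mx B -> dot (B *m u) v = - dot (B *m v) u.
Proof.
move=> skB; rewrite dot_mulmxl skB mulNmx dotNr; congr (- _).
by rewrite dotC.
Qed.

Lemma dot_skew0 n (B : 'M[R]_n) (u : 'cV[R]_n) :
  skew_mx B -> dot (B *m u) u = 0.
Proof. by move=> skB; have := dot_skew u u skB; lra. Qed.

Lemma dot_ge0 n (u : 'cV[R]_n) : 0 <= dot u u.
Proof. by rewrite dotE; apply: sumr_ge0 => i _; rewrite -expr2 sqr_ge0. Qed.

Lemma dot_eq0 n (u : 'cV[R]_n) : dot u u = 0 -> u = 0.
Proof.
rewrite dotE => /eqP; rewrite psumr_eq0; last first.
  by move=> i _; rewrite -expr2 sqr_ge0.
move=> /allP u0; apply/colP => i; rewrite mxE.
have := u0 i (mem_index_enum _); rewrite /= -expr2 sqrf_eq0.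
by move/eqP.
Qed.

(** By [|u - v|^2 = 2 - 2 <u, v>]. *)
Lemma dot_unit_eq n (u v : 'cV[R]_n) :
  dot u u = 1 -> dot v v = 1 -> 1 <= dot u v -> u = v.
Proof.
move=> uu vv uv; apply/eqP; rewrite -subr_eq0; apply/eqP/dot_eq0.
apply/eqP; rewrite eq_le dot_ge0 andbT !dot_lin (dotC v u) uu vv; lra.
Qed.

Lemma unit_entry_le1 n (u : 'cV[R]_n) i : dot u u = 1 -> `|u i 0| <= 1.
Proof.
move=> uu; rewrite -(@ler_pXn2r _ 2)// ?nnegrE// expr1n real_normK ?num_real//.
rewrite -uu dotE (bigD1 i)//= -expr2 lerDl; apply: sumr_ge0 => j _.
by rewrite -expr2 sqr_ge0.
Qed.

(** The Fourier expansion in an orthonormal basis: the matrix with columns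
    [x0, x1, x2, x3] has a one-sided inverse, hence a two-sided one. *)
Lemma orthonormal_expand (x0 x1 x2 x3 u : 'cV[R]_4) :
  [/\ dot x0 x0 = 1, dot x1 x1 = 1, dot x2 x2 = 1 & dot x3 x3 = 1] ->
  [/\ dot x0 x1 = 0, dot x0 x2 = 0 & dot x0 x3 = 0] ->
  [/\ dot x1 x2 = 0, dot x1 x3 = 0 & dot x2 x3 = 0] ->
  u = dot u x0 *: x0 + dot u x1 *: x1 + dot u x2 *: x2 + dot u x3 *: x3.
Proof.
move=> [h00 h11 h22 h33] [h01 h02 h03] [h12 h13 h23].
pose x (i : 'I_4) := nth 0 [:: x0; x1; x2; x3] i.
pose O : 'M[R]_4 := \matrix_(i, j) x j i 0.
have OO : O^T *m O = 1%:M.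
  apply/matrixP => i j; rewrite !mxE.
  transitivity (dot (x i) (x j)).
    by rewrite dotE; apply: eq_bigr => k _; rewrite !mxE.
  by case: i => -[|[|[|[|//]]]] ?; case: j => -[|[|[|[|//]]]] ? //=;
    rewrite /x /= ?h00 ?h11 ?h22 ?h33 ?h01 ?h02 ?h03 ?h12 ?h13 ?h23 //
      dotC ?h01 ?h02 ?h03 ?h12 ?h13 ?h23.
have {}OO := mulmx1C OO.
rewrite -[LHS]mul1mx -OO -mulmxA.
apply/colP => i; rewrite !mxE !big_ord_recl big_ord0 addr0 !mxE.
have d k : \sum_j O^T k j * u j 0 = dot u (x k).
  by rewrite dotE; apply: eq_bigr => j _; rewrite !mxE mulrC.
by rewrite !d /x /=; ring.
Qed.

End Dot.

(** * Skew matrices of size four *)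

Section Skew4.
Context {R : realType}.

(** Coordinates on [so(4)]: the six entries above the diagonal. *)
Definition skew_of (c : 'rV[R]_6) : 'M[R]_4 := \matrix_(i, j)
  nth 0 (nth [::]
   [:: [:: 0; c 0 (inord 0); c 0 (inord 1); c 0 (inord 2)];
       [:: - c 0 (inord 0); 0; c 0 (inord 3); c 0 (inord 4)];
       [:: - c 0 (inord 1); - c 0 (inord 3); 0; c 0 (inord 5)];
       [:: - c 0 (inord 2); - c 0 (inord 4); - c 0 (inord 5); 0]] i) j.

Definition skew_coord (B : 'M[R]_4) : 'rV[R]_6 := \row_k
  nth 0 [:: B (inord 0) (inord 1); B (inord 0) (inord 2);
            B (inord 0) (inord 3); B (inord 1) (inord 2);
            B (inord 1) (inord 3); B (inord 2) (inord 3)] k.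

Let I4 k (h : (k < 4)%N) : Ordinal h = inord k :> 'I_4.
Proof. by apply/val_inj; rewrite /= inordK. Qed.

Let I6 k (h : (k < 6)%N) : Ordinal h = inord k :> 'I_6.
Proof. by apply/val_inj; rewrite /= inordK. Qed.

Lemma skew_of_skew c : skew_mx (skew_of c).
Proof.
apply/matrixP => i j; rewrite !mxE.
by case: i => -[|[|[|[|//]]]] ?; case: j => -[|[|[|[|//]]]] ? //=;
  rewrite ?oppr0 ?opprK.
Qed.

Lemma skew_coordK B : skew_mx B -> skew_of (skew_coord B) = B.
Proof.
move=> skB; have skE i j : B i j = - B j i.
  by have /matrixP/(_ j i) := skB; rewrite !mxE.
have skD i : B i i = 0 by have := skE i i; lra.
apply/matrixP => i j; rewrite !mxE.
by case: i => -[|[|[|[|//]]]] hi; case: j => -[|[|[|[|//]]]] hj //=;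
  rewrite ?mxE ?inordK //= ?I4 ?skD // skE.
Qed.

Lemma skew_ofK : cancel skew_of skew_coord.
Proof.
move=> c; apply/rowP => k; rewrite !mxE.
by case: k => -[|[|[|[|[|[|//]]]]]] hk //=; rewrite ?mxE ?inordK //= ?I6.
Qed.

Lemma skew_of_is_linear : linear skew_of.
Proof.
move=> k b c; apply/matrixP => i j; rewrite !mxE.
by case: i => -[|[|[|[|//]]]] hi; case: j => -[|[|[|[|//]]]] hj //=;
  rewrite ?mxE; ring.
Qed.

HB.instance Definition _ := GRing.isLinear.Build R 'rV[R]_6 'M[R]_4 _ skew_of
  skew_of_is_linear.

Lemma skew_coord_is_linear : linear skew_coord.
Proof.
move=> k b c; apply/rowP => i; rewrite !mxE.
by case: i => -[|[|[|[|[|[|//]]]]]] hk //=; rewrite ?mxE.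
Qed.

HB.instance Definition _ := GRing.isLinear.Build R 'M[R]_4 'rV[R]_6 _ skew_coord
  skew_coord_is_linear.

End Skew4.

(** * Dimension of an image *)

Section Dimension.
Context {R : realType}.

Lemma lin_dim_le (V : lmodType R) (S : set V) (k : nat) :
  (forall (n : nat) (b : 'I_n -> V), lin_indep b -> (forall i, S (b i)) -> (n <= k)%N) ->
  (lin_dim S <= k%:R%:E)%E.
Proof.
move=> h; apply: ge_ereal_sup => _ [n [b [ib bS]] <-].
by rewrite lee_fin ler_nat; exact: h bS.
Qed.

Lemma lin_dim_ge (V : lmodType R) (S : set V) (n : nat) (b : 'I_n -> V) :
  lin_indep b -> (forall i, S (b i)) -> (n%:R%:E <= lin_dim S)%E.
Proof. by move=> ib bS; apply: ereal_sup_ubound; exists n => //; exists b. Qed.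

(** Preimages of independent values, together with the nonzero point of the
    kernel, are independent in [R^k]. *)
Lemma lin_indep_image_lt (V : lmodType R) k (f : {linear 'rV[R]_k -> V})
    (c0 : 'rV[R]_k) n (b : 'I_n -> V) :
  c0 != 0 -> f c0 = 0 -> lin_indep b -> (forall i, exists c, b i = f c) ->
  (n < k)%N.
Proof.
move=> c0n0 fc0 ib bf; rewrite ltnNge; apply/negP => kn.
pose c i := sval (cid (bf i)).
have fcE i : b i = f (c i) by rewrite /c; case: (cid (bf i)).
pose M : 'M[R]_(n + 1, k) := col_mx (\matrix_i c i) c0.
have : kermx M != 0.
  rewrite -mxrank_eq0 mxrank_ker -lt0n subn_gt0.
  by rewrite (leq_ltn_trans (rank_leq_col _))// addn1.
case/rowV0Pn => u /sub_kermxP uM u0.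
have usum : \sum_i lsubmx u 0 i *: c i + rsubmx u 0 0 *: c0 = 0.
  rewrite -[RHS]uM -{3}(hsubmxK u) mul_row_col; congr (_ + _).
    rewrite [RHS]mulmx_sum_row; apply: eq_bigr => i _.
    by rewrite rowK.
  by rewrite [rsubmx u in RHS]mx11_scalar mul_scalar_mx.
have ul0 i : lsubmx u 0 i = 0.
  apply: ib; move/(congr1 f): usum.
  rewrite linearD linear_sum linearZ_LR fc0 scaler0 addr0 linear0 => e; rewrite -[RHS]e.
  by apply: eq_bigr => j _; rewrite fcE linearZ_LR.
move: usum; rewrite big1 ?add0r => [/eqP|i _]; last by rewrite ul0 scale0r.
rewrite scaler_eq0 (negbTE c0n0) orbF => /eqP ur0.
case/negP: u0; apply/eqP; rewrite -(hsubmxK u).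
suff [-> ->] : lsubmx u = 0 /\ rsubmx u = 0 by rewrite row_mx0.
split; apply/rowP => i; rewrite [RHS]mxE ?ul0//.
by rewrite ord1 ur0.
Qed.

End Dimension.

(** * Directional derivatives *)

Section Derivatives.
Context {R : realType} {V : normedModType R}.
Implicit Types (x v : V) (f g : V -> R).

Lemma is_derive_add (W : normedModType R) (f g : V -> W) x v df dg :
  is_derive x v f df -> is_derive x v g dg ->
  is_derive x v (fun y => f y + g y) (df + dg).
Proof. by move=> hf hg; exact: (is_deriveD hf hg). Qed.

Lemma is_derive_opp (W : normedModType R) (f : V -> W) x v df :
  is_derive x v f df -> is_derive x v (fun y => - f y) (- df).
Proof. by move=> hf; exact: (is_deriveN hf). Qed.

Lemma is_derive_sub (W : normedModType R) (f g : V -> W) x v df dg :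
  is_derive x v f df -> is_derive x v g dg ->
  is_derive x v (fun y => f y - g y) (df - dg).
Proof. by move=> hf hg; apply: is_derive_add => //; exact: is_derive_opp. Qed.

Lemma is_derive_mul f g x v df dg :
  is_derive x v f df -> is_derive x v g dg ->
  is_derive x v (fun y => f y * g y) (df * g x + f x * dg).
Proof.
move=> hf hg; apply: (is_derive_eq (is_deriveM hf hg)).
by rewrite addrC [g x *: _]mulrC.
Qed.

Lemma is_derive_const (W : normedModType R) (c : W) x v :
  is_derive x v (fun=> c) 0.
Proof. exact: is_derive_cst. Qed.

Lemma is_derive_lsum (W : normedModType R) n (f : 'I_n -> V -> W) x v df :
  (forall i, is_derive x v (f i) (df i)) ->
  is_derive x v (fun y => \sum_i f i y) (\sum_i df i).
Proof.
move=> hf; rewrite (_ : (fun y => _) = \sum_i f i); first exact: is_derive_sum.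
by apply/funext => y; rewrite fct_sumE.
Qed.

Lemma is_derive_fun (W : normedModType R) (f g : V -> W) x v df :
  (forall y, f y = g y) -> is_derive x v f df -> is_derive x v g df.
Proof. by move=> /funext ->. Qed.

Lemma is_derive_val (W : normedModType R) (f : V -> W) x v df df' :
  is_derive x v f df -> is_derive x v f df' -> df = df'.
Proof. by move=> h h'; rewrite -(@derive_val _ _ _ _ _ _ _ h) derive_val. Qed.

Lemma is_derive_const_eq0 (F : V -> R) c x v d :
  (forall y, F y = c) -> is_derive x v F d -> d = 0.
Proof.
move=> /funext Fc; rewrite (_ : F = cst c) => [h|]; last exact: Fc.
exact: is_derive_val h (is_derive_const c x v).
Qed.

Lemma is_derive_mx m n (M : V -> 'M[R]_(m, n)) x v (dM : 'M[R]_(m, n)) :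
  (forall i j, is_derive x v (fun y => M y i j) (dM i j)) ->
  is_derive x v M dM.
Proof.
move=> hM; have dM' : derivable M x v by apply/derivable_mxP => i j.
apply: DeriveDef => //; rewrite derive_mx//; apply/matrixP => i j.
by rewrite mxE derive_val.
Qed.

Lemma is_derive_entry m n (M : V -> 'M[R]_(m, n)) x v (dM : 'M[R]_(m, n)) i j :
  is_derive x v M dM -> is_derive x v (fun y => M y i j) (dM i j).
Proof.
move=> hM; have dM' : derivable M x v by [].
apply: DeriveDef; first by move/derivable_mxP: dM'.
by rewrite -[dM](@derive_val _ _ _ _ _ _ _ hM) derive_mx// mxE.
Qed.

Lemma is_derive_dot n (f g : V -> 'cV[R]_n) x v (df dg : 'cV[R]_n) :
  is_derive x v f df -> is_derive x v g dg ->
  is_derive x v (fun y => dot (f y) (g y)) (dot df (g x) + dot (f x) dg).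
Proof.
move=> hf hg; apply: (@is_derive_fun _ (fun y => \sum_i f y i 0 * g y i 0)).
  by move=> y; rewrite dotE.
rewrite !dotE -big_split /=; apply: is_derive_lsum => i.
by apply: is_derive_mul; exact: is_derive_entry.
Qed.

Lemma dot_const_derive n (f g : V -> 'cV[R]_n) c x v (df dg : 'cV[R]_n) :
  (forall y, dot (f y) (g y) = c) -> is_derive x v f df -> is_derive x v g dg ->
  dot df (g x) = - dot (f x) dg.
Proof.
move=> fg hf hg; apply/eqP; rewrite -subr_eq0 opprK; apply/eqP.
exact: is_derive_const_eq0 fg (is_derive_dot hf hg).
Qed.

Lemma norm_const_derive n (f : V -> 'cV[R]_n) c x v (df : 'cV[R]_n) :
  (forall y, dot (f y) (f y) = c) -> is_derive x v f df -> dot df (f x) = 0.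
Proof.
move=> ff hf; have := dot_const_derive ff hf hf; rewrite [dot (f x) _]dotC.
by move: (dot _ _) => k ?; lra.
Qed.

Lemma is_derive_mulmxl m n p (B : 'M[R]_(m, n)) (f : V -> 'M[R]_(n, p)) x v
    (df : 'M[R]_(n, p)) :
  is_derive x v f df -> is_derive x v (fun y => B *m f y) (B *m df).
Proof.
move=> hf; apply: is_derive_mx => i j; rewrite mxE.
apply: (@is_derive_fun _ (fun y => \sum_k B i k * f y k j)).
  by move=> y; rewrite mxE.
apply: is_derive_lsum => k.
apply: (is_derive_eq (is_derive_mul (is_derive_const (B i k) x v)
  (is_derive_entry k j hf))).
by rewrite mul0r add0r.
Qed.

Lemma is_derive_scale m n (k : V -> R) (f : V -> 'M[R]_(m, n)) x v dk
    (df : 'M[R]_(m, n)) :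
  is_derive x v k dk -> is_derive x v f df ->
  is_derive x v (fun y => k y *: f y) (dk *: f x + k x *: df).
Proof.
move=> hk hf; apply: is_derive_mx => i j; rewrite !mxE.
apply: (@is_derive_fun _ (fun y => k y * f y i j)); first by move=> y; rewrite mxE.
by apply: is_derive_mul => //; exact: is_derive_entry.
Qed.

End Derivatives.

(** * Restriction to lines, symmetry of second derivatives *)

Section Lines.
Context {R : realType} {V : normedModType R}.
Implicit Types (x v w : V) (F : V -> R).

Lemma is_derive_line (W : normedModType R) (f : V -> W) x v s :
  derivable f (x + s *: v) v ->
  is_derive s 1 (fun t => f (x + t *: v)) ('D_v f (x + s *: v)).
Proof.
move=> df; rewrite /derivable in df.
have E : (fun h : R => h^-1 *: (((fun t => f (x + t *: v)) \o shift s) (h *: 1) -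
    f (x + s *: v))) =
  (fun h => h^-1 *: ((f \o shift (x + s *: v)) (h *: v) - f (x + s *: v))).
  apply/funext => h /=; congr (_ *: (f _ - _)).
  by rewrite [h%:A]mulr1 scalerDl addrCA.
by apply: DeriveDef; rewrite ?/derivable ?/derive /= E.
Qed.

Lemma MVT_line F x v h : 0 <= h -> (forall y, derivable F y v) ->
  exists2 s, 0 <= s <= h & F (x + h *: v) - F x = h * 'D_v F (x + s *: v).
Proof.
move=> h0 dF.
have dl s := @is_derive_line _ F x v s (dF _).
have [|s] := @MVT_segment R (fun t => F (x + t *: v))
  (fun s => 'D_v F (x + s *: v)) 0 h h0 (fun s _ => dl s).
  apply: continuous_subspaceT => s; apply/differentiable_continuous.
  by apply/derivable1_diffP; case: (dl s).
rewrite in_itv /= scale0r addr0 subr0 => sh e; exists s => //.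
by rewrite e mulrC.
Qed.

Lemma derive0_const F x y : (forall z v, is_derive z v F 0) -> F x = F y.
Proof.
move=> dF; have := @is_derive_0_is_cst R (fun t => F (x + t *: (y - x))) 0 1.
rewrite scale0r addr0 scale1r subrKC; apply => s.
have := @is_derive_line _ F x (y - x) s.
by rewrite (@derive_val _ _ _ _ _ _ _ (dF _ _)); apply.
Qed.

Lemma derive_at_min F x v :
  (forall y, derivable F y v) -> (forall y, F x <= F y) -> is_derive x v F 0.
Proof.
move=> dF minF; apply: DeriveDef => //.
have l s := @is_derive_line _ F x v s (dF _).
have [||||_ <-] := @derive1_at_min R (fun t => F (x + t *: v)) (-1) 1 0.
- by lra.
- by move=> t _; case: (l t).
- by rewrite in_itv/=; apply/andP; split; lra.
- by move=> t _; rewrite scale0r addr0.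
- by rewrite (@derive_val _ _ _ _ _ _ _ (l 0)) scale0r addr0.
Qed.

Lemma derive_at_max F x v :
  (forall y, derivable F y v) -> (forall y, F y <= F x) -> is_derive x v F 0.
Proof.
move=> dF maxF; rewrite -oppr0 -[F]opprK; apply: is_deriveN.
apply: derive_at_min => y; first exact: derivableN.
by rewrite lerN2.
Qed.

(** The mean value theorem, applied in the direction [v] to
    [F (. + h w) - F] and then in the direction [w] to ['D_v F]. *)
Lemma second_difference F x v w h : 0 <= h ->
  (forall y, derivable F y v) -> (forall y, derivable ('D_v F) y w) ->
  exists s t, [/\ 0 <= s <= h, 0 <= t <= h &
    F (x + h *: v + h *: w) - F (x + h *: v) - F (x + h *: w) + F x =
    h * (h * 'D_w ('D_v F) (x + s *: v + t *: w))].
Proof.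
move=> h0 dF ddF.
pose G y := F (y + h *: w) - F y.
have dG y : is_derive y v G ('D_v F (y + h *: w) - 'D_v F y).
  apply: is_derive_sub; last by apply: DeriveDef.
  have E : (fun k : R => k^-1 *: (((fun y => F (y + h *: w)) \o shift y) (k *: v) -
      F (y + h *: w))) =
    (fun k => k^-1 *: ((F \o shift (y + h *: w)) (k *: v) - F (y + h *: w))).
    by apply/funext => k /=; rewrite addrA.
  have := dF (y + h *: w); rewrite /derivable -E => d.
  by apply: DeriveDef; rewrite // /derive -E.
have [|s sh Gs] := @MVT_line G x v h h0; first by move=> y; case: (dG y).
have [|t th Ft] := @MVT_line ('D_v F) (x + s *: v) w h h0; first by [].
exists s, t; split=> //; rewrite -Ft -(@derive_val _ _ _ _ _ _ _ (dG _)) -Gs /G.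
by rewrite opprB; ring.
Qed.

(** Both iterated derivatives are limits of the same second difference. *)
Lemma derive_sym F x v w :
  (forall y, derivable F y v) -> (forall y, derivable F y w) ->
  (forall y, derivable ('D_v F) y w) -> (forall y, derivable ('D_w F) y v) ->
  {for x, continuous ('D_w ('D_v F))} -> {for x, continuous ('D_v ('D_w F))} ->
  'D_w ('D_v F) x = 'D_v ('D_w F) x.
Proof.
move=> dv dw dvw dwv cvw cwv.
suff close e : 0 < e -> `|'D_w ('D_v F) x - 'D_v ('D_w F) x| <= e.
  by apply/eqP; rewrite -subr_eq0 -normr_le0; apply/ler_addgt0Pr => e /close;
    rewrite add0r.
move=> e0.
have e20 : 0 < e / 2 by rewrite divr_gt0.
have /cvgrPdist_le/(_ _ e20)/nbhs_ballP[d1 /= d10 close1] := cvw.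
have /cvgrPdist_le/(_ _ e20)/nbhs_ballP[d2 /= d20 close2] := cwv.
pose d := Num.min d1 d2; pose h := d / 2 / (`|v| + `|w| + 1).
have d0 : 0 < d by rewrite lt_min d10.
have K0 : 0 < `|v| + `|w| + 1 by rewrite ltr_wpDl// addr_ge0.
have h0 : 0 < h by rewrite !divr_gt0.
have hd u u' s t : 0 <= s <= h -> 0 <= t <= h -> `|u| + `|u'| = `|v| + `|w| ->
    `|x - (x + s *: u + t *: u')| < d.
  move=> /andP[s0 sh] /andP[t0 th] uE.
  rewrite -addrA opprD addNKr normrN (le_lt_trans (ler_normD _ _))//.
  rewrite !normrZ (ger0_norm s0) (ger0_norm t0).
  apply: (@le_lt_trans _ _ (h * (`|v| + `|w| + 1))).
    rewrite -uE mulrDr mulrDr mulr1 -[leLHS]addr0.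
    by do !apply: lerD; rewrite ?ler_wpM2r// ltW.
  by rewrite /h divfK ?gt_eqF// ltr_pdivrMr// ltr_pMr// ltr1n.
have [s [t [sh th E1]]] := @second_difference F x v w h (ltW h0) dv dvw.
have [s' [t' [sh' th' E2]]] := @second_difference F x w v h (ltW h0) dw dwv.
have {}h1 : ball x d1 (x + s *: v + t *: w).
  by rewrite -ball_normE/= (lt_le_trans (hd _ _ _ _ sh th _))// ge_min lexx.
have {}h2 : ball x d2 (x + s' *: w + t' *: v).
  rewrite -ball_normE/= (lt_le_trans (hd _ _ _ _ sh' th' _))// ?ge_min ?lexx ?orbT//.
  by rewrite addrC.
move: E1 E2 (close1 _ h1) (close2 _ h2).
set z := 'D_w _ (x + _ + _); set z' := 'D_v _ (x + _ + _); move: z z' => z z'.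
move: ('D_w _ x) ('D_v _ x) => a b.
rewrite (addrAC x (h *: w)); set p := F _; set q := F _; set q' := F _.
move: p q q' => p q q' E1 E2 az bz'.
have {bz'} bz : `|b - z| <= e / 2.
  have hn0 : h != 0 by rewrite gt_eqF.
  suff -> : z = z' by [].
  by apply/(mulfI hn0)/(mulfI hn0); lra.
by rewrite -(subrKA z) (splitr e) (le_trans (ler_normD _ _))// lerD// distrC.
Qed.

End Lines.

(** * Smooth maps and derivatives along vector fields *)

Section Smooth.
Context {R : realType}.

Lemma smooth_diff (V W : normedModType R) (f : V -> W) x :
  smooth f -> differentiable f x.
Proof. by move=> /(_ 1%N)[]. Qed.

Lemma smooth_derivable (V W : normedModType R) (f : V -> W) x v :
  smooth f -> derivable f x v.
Proof. by move=> sf; apply: diff_derivable; exact: smooth_diff. Qed.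

Lemma smooth_derive (V W : normedModType R) (f : V -> W) v :
  smooth f -> smooth ('D_v f).
Proof. by move=> sf k; have [_] := sf k.+1; apply. Qed.

Lemma smooth_continuous (V W : normedModType R) (f : V -> W) :
  smooth f -> continuous f.
Proof. by move=> /(_ 0%N). Qed.

Lemma deriveDr (V W : normedModType R) (f : V -> W) x v w :
  differentiable f x -> 'D_(v + w) f x = 'D_v f x + 'D_w f x.
Proof.
by move=> df; rewrite (deriveE _ df) linearD (deriveE v df) (deriveE w df).
Qed.

Lemma deriveZr (V W : normedModType R) (f : V -> W) x k v :
  differentiable f x -> 'D_(k *: v) f x = k *: 'D_v f x.
Proof. by move=> df; rewrite (deriveE _ df) linearZ (deriveE v df). Qed.

End Smooth.

Arguments smooth_diff {R V W f} x.
Arguments smooth_derivable {R V W f} x v.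
Arguments smooth_derive {R V W f} v.

Section SmoothMatrix.
Context {R : realType}.
Let P := 'rV[R]_2.

Lemma continuous_entry (V : normedModType R) m n (f : V -> 'M[R]_(m, n)) i j :
  continuous f -> continuous (fun y => f y i j).
Proof.
move=> cf x; apply: (@continuous_comp _ _ _ f (fun M => M i j)); first exact: cf.
exact: coord_continuous.
Qed.

Lemma derive_entry (V : normedModType R) m n (f : V -> 'M[R]_(m, n)) x v i j :
  derivable f x v -> 'D_v (fun y => f y i j) x = 'D_v f x i j.
Proof. by move=> df; rewrite derive_mx// mxE. Qed.

Lemma smooth_derive_sym m n (f : P -> 'M[R]_(m, n)) x v w :
  smooth f -> 'D_w ('D_v f) x = 'D_v ('D_w f) x.
Proof.
move=> sf; apply/matrixP => i j.
have d1 u y : derivable (fun y => f y i j) y u.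
  by have /derivable_mxP/(_ i j) := smooth_derivable y u sf.
have e u : 'D_u (fun y => f y i j) = fun y => 'D_u f y i j.
  by apply/funext => y; rewrite derive_entry//; exact: smooth_derivable.
have d2 u u' y : derivable ('D_u (fun y => f y i j)) y u'.
  rewrite e; have sf' := smooth_derive u sf.
  by have /derivable_mxP/(_ i j) := smooth_derivable y u' sf'.
have ee u u' : 'D_u' ('D_u (fun y => f y i j)) = fun y => 'D_u' ('D_u f) y i j.
  apply/funext => y; rewrite e derive_entry//.
  by apply: smooth_derivable; exact: smooth_derive.
have c u u' : continuous ('D_u' ('D_u (fun y => f y i j))).
  rewrite ee; apply: continuous_entry; apply: smooth_continuous.
  by do 2!apply: smooth_derive.
have ex u u' : 'D_u' ('D_u (fun y => f y i j)) x = 'D_u' ('D_u f) x i j.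
  exact: (congr1 (@^~ x) (ee u u')).
have s := derive_sym (d1 v) (d1 w) (d2 v w) (d2 w v) (c v w x) (c w v x).
exact: etrans (esym (ex v w)) (etrans s (ex w v)).
Qed.

Lemma derive_coordE m n (f : P -> 'M[R]_(m, n)) x (v : P) : smooth f ->
  'D_v f x = \sum_i v 0 i *: 'D_(delta_mx 0 i) f x.
Proof.
move=> sf; have df := smooth_diff x sf.
rewrite (deriveE v df) {1}(row_sum_delta v) linear_sum.
by apply: eq_bigr => i _; rewrite linearZ (deriveE _ df).
Qed.

(** Differentiating [df (Y)] for a vector field [Y] produces the second
    derivative of [f] with [Y] held at its value [Y x], and the derivative of
    [f] along the derivative of [Y]. *)
Lemma is_derive_field m n (f : P -> 'M[R]_(m, n)) (Y : P -> P) x w dY :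
  smooth f -> is_derive x w Y dY ->
  is_derive x w (fun y => 'D_(Y y) f y) ('D_w ('D_(Y x) f) x + 'D_dY f x).
Proof.
move=> sf hY.
apply: (@is_derive_fun _ _ _ (fun y => \sum_i Y y 0 i *: 'D_(delta_mx 0 i) f y)).
  by move=> y; rewrite -derive_coordE.
apply: is_derive_eq.
  apply: is_derive_lsum => i; apply: is_derive_scale.
    exact: (is_derive_entry 0 i hY).
  by apply: derivableP; apply: smooth_derivable; exact: smooth_derive.
rewrite big_split /= addrC -(derive_coordE x dY sf); congr (_ + _).
rewrite (smooth_derive_sym x (Y x) w sf).
rewrite (derive_coordE x (Y x) (smooth_derive w sf)).
by apply: eq_bigr => i _; rewrite (smooth_derive_sym x _ w sf).
Qed.

End SmoothMatrix.

(** * Norms of matrices *)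

Section MatrixNorm.
Context {R : realType}.

Lemma mx_entry_le m n (A : 'M[R]_(m, n)) i j : `|A i j| <= `|A|.
Proof.
by rewrite [leRHS]/Num.Def.normr/= mx_normrE; exact: (le_bigmax _ _ (i, j)).
Qed.

Lemma mx_norm_le m n (A : 'M[R]_(m, n)) c :
  0 <= c -> (forall i j, `|A i j| <= c) -> `|A| <= c.
Proof.
by move=> c0 h; rewrite [leLHS]/Num.Def.normr/= mx_normrE; apply: bigmax_le => // i _.
Qed.

Lemma mx_norm_mul m n p (A : 'M[R]_(m, n)) (B : 'M[R]_(n, p)) :
  `|A *m B| <= n%:R * `|A| * `|B|.
Proof.
apply: mx_norm_le => [|i j]; first by rewrite !mulr_ge0.
rewrite mxE (le_trans (ler_norm_sum _ _ _))//.
apply: (@le_trans _ _ (\sum_(k < n) `|A| * `|B|)).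
  by apply: ler_sum => k _; rewrite normrM ler_pM// mx_entry_le.
by rewrite sumr_const card_ord -mulrA mulr_natl.
Qed.

Lemma dot_norm_le n (u v : 'cV[R]_n) : `|dot u v| <= n%:R * `|u| * `|v|.
Proof.
rewrite dotE (le_trans (ler_norm_sum _ _ _))//.
apply: (@le_trans _ _ (\sum_(k < n) `|u| * `|v|)).
  by apply: ler_sum => k _; rewrite normrM ler_pM// mx_entry_le.
by rewrite sumr_const card_ord -mulrA mulr_natl.
Qed.

Lemma unit_norm_le1 n (u : 'cV[R]_n) : dot u u = 1 -> `|u| <= 1.
Proof.
by move=> uu; apply: mx_norm_le => // i j; rewrite ord1; exact: unit_entry_le1.
Qed.

Lemma cvg_mx T (F : set_system T) {FF : Filter F} m n (f : T -> 'M[R]_(m, n))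
    (l : 'M[R]_(m, n)) :
  (forall i j, (fun x => f x i j) @ F --> l i j) -> f @ F --> l.
Proof.
move=> h; apply/cvgrPdist_le => e e0; near=> x.
suff H (ij : 'I_m * 'I_n) : `|l ij.1 ij.2 - f x ij.1 ij.2| <= e.
  by apply: mx_norm_le => [|i j]; [exact: ltW | rewrite !mxE; exact: (H (i, j))].
move: ij; near: x; apply: filter_forall => -[i j] /=.
by have /cvgrPdist_le := h i j; apply.
Unshelve. all: by end_near. Qed.

Lemma derive_first_order (V W : normedModType R) (f : V -> W) x v df e :
  is_derive x v f df -> 0 < e -> exists2 d, 0 < d &
  forall h, `|h| < d -> `|f (x + h *: v) - f x - h *: df| <= e * `|h|.
Proof.
move=> hf e0.
have : h^-1 *: ((f \o shift x) (h *: v) - f x) @[h --> 0^'] --> df.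
  by rewrite -[df](@derive_val _ _ _ _ _ _ _ hf); exact: (@ex_derive _ _ _ _ _ _ _ hf).
move=> /cvgrPdist_le/(_ _ e0)[d /= d0 hd]; exists d => // h hl.
have [->|h0] := eqVneq h 0; first by rewrite !scale0r addr0 subrr subr0 !normr0 mulr0.
have /= := hd h; rewrite sub0r normrN => /(_ hl h0).
rewrite -(ler_pM2r (_ : 0 < `|h|)) ?normr_gt0// [x + _]addrC; apply: le_trans.
rewrite [leRHS]mulrC -normrZ scalerBr scalerA divff// scale1r distrC//.
Qed.

End MatrixNorm.

(** * The exponential of a skew matrix *)

Section MatrixExponential.
Context {R : realType} {n : nat}.
Implicit Types (B M : 'M[R]_n.+1) (s t : R).

(** The Taylor coefficients in [t] of the [(i, j)] entry of [M e^{tB}]; the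
    factor [M] makes the family stable under termwise differentiation. *)
Definition exp_entry B M i j (k : nat) : R := (k`!%:R)^-1 * (M * B ^+ k) i j.

Lemma exp_entry_diffs B M i j :
  pseries_diffs (exp_entry B M i j) = exp_entry B (M * B) i j.
Proof.
apply/funext => k; rewrite /pseries_diffs /exp_entry factS natrM invfM.
rewrite exprS (mulrA M); set X := (fun_of_matrix _ i j).
by rewrite !mulrA mulfV ?pnatr_eq0// mul1r.
Qed.

Lemma mx_norm_mulX B M k :
  `|M * B ^+ k| <= `|M| * (n.+1%:R * `|B|) ^+ k.
Proof.
elim: k => [|k ih]; first by rewrite !expr0 !mulr1.
rewrite exprSr mulrA (le_trans (mx_norm_mul _ _))// exprSr !mulrA.
by rewrite ler_wpM2r// mulrC ler_wpM2r.
Qed.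

(** Comparison with the series of [|M| e^{(n + 1) |B| |t|}]. *)
Lemma cvg_exp_entry B M i j t : cvgn (pseries (exp_entry B M i j) t).
Proof.
apply: normed_cvg; rewrite /normed_series_of /=.
apply: (@series_le_cvg _ _
  (fun k => `|M| * exp_coeff (n.+1%:R * `|B| * `|t|) k)) => [k|k|k|] /=.
- by [].
- by rewrite !mulr_ge0// ?invr_ge0// exprn_ge0// !mulr_ge0.
- rewrite /exp_entry exp_coeffE normrM normrM normfV normr_nat exprMn normrX.
  rewrite mulrCA -mulrA ler_wpM2l ?invr_ge0// mulrA ler_wpM2r ?exprn_ge0//.
  exact: le_trans (mx_entry_le _ _ _) (mx_norm_mulX _ _ _).
have := @is_cvg_seriesZ _ _ `|M| (is_cvg_series_exp_coeff (n.+1%:R * `|B| * `|t|)).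
by [].
Qed.

Definition exp_sum B M t : 'M[R]_n.+1 :=
  \matrix_(i, j) limn (pseries (exp_entry B M i j) t).

Lemma is_derive_exp_sum B M t :
  is_derive t 1 (exp_sum B M) (exp_sum B (M * B) t).
Proof.
apply: is_derive_mx => i j; rewrite mxE -exp_entry_diffs.
apply: (@is_derive_fun _ _ _ (fun s => limn (pseries (exp_entry B M i j) s))).
  by move=> s; rewrite mxE.
apply: (@pseries_snd_diffs _ _ (`|t| + 1)); rewrite ?exp_entry_diffs;
  do ?exact: cvg_exp_entry.
by rewrite [ltRHS]ger0_norm ?ltrDl// addr_ge0.
Qed.

Lemma expmx_sum B t : expmx (t *: B) = exp_sum B 1 t.
Proof.
apply: cvg_lim => //; apply: cvg_mx => i j; rewrite mxE.
rewrite [X in X @ _ --> _](_ : _ = pseries (exp_entry B 1 i j) t).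
  exact: cvg_exp_entry.
apply/funext => k; rewrite /pseries /series /= summxE.
apply: eq_bigr => l _; rewrite mxE /exp_entry mul1r exprZn mxE.
by rewrite -mulrA [t ^+ l * _]mulrC.
Qed.

Lemma exp_sum_mul B M t : exp_sum B M t = M * exp_sum B 1 t.
Proof.
apply/matrixP => i j; rewrite !mxE; apply: cvg_lim => //.
rewrite [X in X @ _ --> _](_ : _ =
    fun k => \sum_l M i l * pseries (exp_entry B 1 l j) t k).
  rewrite (_ : (fun k => _) =
      \sum_l (fun k => M i l * pseries (exp_entry B 1 l j) t k)); last first.
    by apply/funext => k; rewrite fct_sumE.
  elim/big_ind2: _ => [|? ? ? ?|l _]; [exact: cvg_cst|exact: cvgD|].
  by apply: cvgMl_tmp; rewrite mxE; exact: cvg_exp_entry.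
apply/funext => k; rewrite /pseries /series /=.
under [RHS]eq_bigr do rewrite mulr_sumr.
rewrite exchange_big /=; apply: eq_bigr => l _.
rewrite /exp_entry mul1r mxE -mulrA mulr_suml mulr_sumr.
by apply: eq_bigr => p _; ring.
Qed.

Lemma is_derive_expmx B t :
  is_derive t 1 (fun s => expmx (s *: B)) (B *m expmx (t *: B)).
Proof.
apply: (@is_derive_fun _ _ _ (exp_sum B 1)) => [s|]; first by rewrite expmx_sum.
apply: (is_derive_eq (is_derive_exp_sum B 1 t)).
by rewrite expmx_sum mul1r exp_sum_mul.
Qed.

Lemma expmx0 B : expmx (0 *: B) = 1%:M.
Proof.
rewrite scale0r; apply: cvg_lim => //.
apply: cvg_near_cst; near=> k.
have -> : k = k.-1.+1 by rewrite prednK//; near: k; exact: nbhs_infty_gt.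
rewrite /series /= big_nat_recl// big1 ?addr0 => [|l _].
  by rewrite expr0 fact0 invr1 scale1r.
by rewrite expr0n scaler0.
Unshelve. all: by end_near. Qed.

(** The derivative is [Y^T (B^T + B) Z = 0]. Comparing [e^{tB}] with itself
    gives the orthogonality, comparing it with [e^{(t+s)B}] the group law. *)
Lemma skew_flow_gram B (Y Z : R -> 'M[R]_n.+1) t : skew_mx B ->
  (forall t, is_derive t 1 Y (B *m Y t)) ->
  (forall t, is_derive t 1 Z (B *m Z t)) ->
  (Y t)^T *m Z t = (Y 0)^T *m Z 0.
Proof.
move=> skB hY hZ; apply/matrixP => i j.
have e t' : ((Y t')^T *m Z t') i j = dot (col i (Y t')) (col j (Z t')).
  by rewrite dotE mxE; apply: eq_bigr => k _; rewrite !mxE.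
rewrite !e.
apply: (@is_derive_0_is_cst R (fun t => dot (col i (Y t)) (col j (Z t)))) => s.
have hcol (X : R -> 'M[R]_n.+1) k : is_derive s 1 X (B *m X s) ->
    is_derive s 1 (fun t => col k (X t)) (B *m col k (X s)).
  move=> hX; apply: is_derive_mx => a b.
  apply: (@is_derive_fun _ _ _ (fun t => X t a k)) => [y|]; first by rewrite mxE.
  have := is_derive_entry a k hX.
  suff -> : (B *m col k (X s)) a b = (B *m X s) a k by [].
  by rewrite !mxE; apply: eq_bigr => c _; rewrite mxE.
apply: (is_derive_eq (is_derive_dot (hcol _ i (hY s)) (hcol _ j (hZ s)))).
by rewrite dot_skew// [dot _ (B *m _)]dotC addNr.
Qed.

Lemma expmx_orthogonal B t : skew_mx B ->
  (expmx (t *: B))^T *m expmx (t *: B) = 1%:M.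
Proof.
move=> skB; rewrite (skew_flow_gram t skB (is_derive_expmx B) (is_derive_expmx B)).
by rewrite expmx0 trmx1 mul1mx.
Qed.

Lemma expmxD B s t : skew_mx B ->
  expmx ((t + s) *: B) = expmx (t *: B) *m expmx (s *: B).
Proof.
move=> skB.
have hZ (u : R) : is_derive u 1 (fun t : R => expmx ((t + s) *: B))
    (B *m expmx ((u + s) *: B)).
  have h := is_derive_expmx B (s + u *: 1).
  have := @is_derive_line R R _ (fun t => expmx (t *: B)) s 1 u
    (@ex_derive _ _ _ _ _ _ _ h).
  rewrite (@derive_val _ _ _ _ _ _ _ h) [u *: 1]mulr1 [s + u]addrC.
  by apply: is_derive_fun => y; rewrite [y *: 1]mulr1 addrC.
have := skew_flow_gram t skB (is_derive_expmx B) hZ.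
rewrite expmx0 add0r trmx1 mul1mx => <-.
by rewrite mulmxA (mulmx1C (expmx_orthogonal t skB)) mul1mx.
Qed.

Lemma expmxN B t : skew_mx B -> expmx (t *: B) *m expmx (- t *: B) = 1%:M.
Proof. by move=> skB; rewrite -expmxD// subrr expmx0. Qed.

Lemma dot_expmx B t (u v : 'cV[R]_n.+1) : skew_mx B ->
  dot (expmx (t *: B) *m u) (expmx (t *: B) *m v) = dot u v.
Proof.
by move=> skB; rewrite dot_mulmxl mulmxA expmx_orthogonal// mul1mx.
Qed.

Lemma expmx_first_order B e : 0 < e -> exists2 d, 0 < d &
  forall h, `|h| < d -> `|expmx (h *: B) - 1%:M - h *: B| <= e * `|h|.
Proof.
move=> e0; have := is_derive_expmx B 0; rewrite expmx0 mulmx1 => hB.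
have [d d0 hd] := derive_first_order hB e0; exists d => // h /hd.
by rewrite add0r expmx0 [h%:A]mulr1.
Qed.

End MatrixExponential.

(** * Maps on the torus and tangent planes *)

Section TorusMaps.
Context {R : realType}.
Let P := 'rV[R]_2.

Definition unit_square : set P := [set v : P | forall i, v 0 i \in `[0, 1]].

Lemma compact_unit_square : compact unit_square.
Proof.
apply: (@rV_compact _ _ (fun=> `[(0 : R), 1]%classic)) => _.
exact: segment_compact.
Qed.

Lemma torus_reduce T (f : P -> T) x : torus_map f ->
  exists2 y, unit_square y & f y = f x.
Proof.
move=> tf; exists (x + map_mx intr (\row_i - Num.floor (x 0 i))); last exact: tf.
move=> i; rewrite !mxE in_itv /= mulrNz subr_ge0 floor_le /= ?num_real//.
by rewrite lerBlDl ltW// -[X in _ + X](mulr1z 1) -intrD floorD1_gt ?num_real.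
Qed.

Lemma torus_max (F : P -> R) : continuous F -> torus_map F ->
  exists m, forall y, F y <= F m.
Proof.
move=> cF tF.
have [||m _ mF] := @EVT_max_rV R 2 F unit_square _ compact_unit_square.
- exists 0 => i; rewrite mxE in_itv /= lexx ler01//.
- exact: continuous_subspaceT.
exists m => y; have [z zQ <-] := torus_reduce y tF.
by apply: mF; rewrite inE.
Qed.

End TorusMaps.

Section Jacobian.
Context {R : realType}.

(** The differential as a matrix acting on row vectors, so that rank arguments
    apply to it. *)
Definition jacobian (f : 'rV[R]_2 -> 'cV[R]_4) m : 'M[R]_(2, 4) :=
  \matrix_(i, j) 'd f m (delta_mx 0 i) j 0.

Lemma jacobianE f m (c : 'rV[R]_2) : (c *m jacobian f m)^T = 'd f m c.
Proof.
rewrite [in RHS](row_sum_delta c) linear_sum; apply/colP => k.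
rewrite !mxE summxE; apply: eq_bigr => i _.
by rewrite mxE linearZ mxE.
Qed.

End Jacobian.

Section TangentPlane.
Context {R : realType}.
Variables (rho N : 'rV[R]_2 -> 'cV[R]_4).
Hypotheses (hrho : immersion_S3 rho) (hN : gauss_map rho N).

Lemma dot_rho_tangent m v : dot (rho m) ('d rho m v) = 0.
Proof.
have [sr _ r1 _] := hrho.
have h := derivableP (smooth_derivable m v sr).
have := is_derive_const_eq0 r1 (is_derive_dot h h).
by rewrite (deriveE v (smooth_diff m sr)) (dotC _ (rho m)); lra.
Qed.

(** The differential of an immersion, the position and the normal together
    give an injective, hence invertible, [4 x 4] matrix. *)
Lemma tangent_vector m u :
  dot u (rho m) = 0 -> dot u (N m) = 0 -> exists v, u = 'd rho m v.
Proof.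
move=> ur uN; have [sr _ r1 inj] := hrho; have [sN _ N1 Nr Nd] := hN.
pose K : 'M[R]_(2 + (1 + 1), 4) := col_mx (jacobian rho m) (col_mx (rho m)^T (N m)^T).
have KE (c : 'rV[R]_(2 + (1 + 1))) : (c *m K)^T = 'd rho m (lsubmx c) +
    (lsubmx (rsubmx c) 0 0 *: rho m + rsubmx (rsubmx c) 0 0 *: N m).
  rewrite -{1}(hsubmxK c) mul_row_col -{1}(hsubmxK (rsubmx c)) mul_row_col.
  rewrite !linearD /= jacobianE {1}[lsubmx (rsubmx c)]mx11_scalar.
  rewrite {1}[rsubmx (rsubmx c)]mx11_scalar !mul_scalar_mx !linearZ /=.
  by rewrite !trmxK.
have cr c : dot (c *m K)^T (rho m) = lsubmx (rsubmx c) 0 0.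
  rewrite KE !dot_lin r1 Nr [dot ('d _ _ _) _]dotC dot_rho_tangent.
  by rewrite mulr0 mulr1 !add0r addr0.
have cN c : dot (c *m K)^T (N m) = rsubmx (rsubmx c) 0 0.
  rewrite KE !dot_lin N1 (dotC (rho m)) Nr [dot ('d _ _ _) _]dotC Nd.
  by rewrite mulr0 mulr1 !add0r.
have Kunit : K \in unitmx.
  rewrite -row_free_unit -kermx_eq0; apply/eqP/row_matrixP => i.
  rewrite row0; set c := row i _.
  have cK : c *m K = 0 by rewrite /c -row_mul mulmx_ker row0.
  move: (cr c) (cN c) (KE c); rewrite cK trmx0 !dot_lin => r0 n0.
  rewrite -r0 -n0 !scale0r !addr0 => /esym e.
  have l0 : lsubmx c = 0 by apply: (inj m); rewrite e linear0.
  rewrite -(hsubmxK c) -(hsubmxK (rsubmx c)) l0.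
  rewrite [lsubmx (rsubmx c)]mx11_scalar [rsubmx (rsubmx c)]mx11_scalar -r0 -n0.
  by rewrite !raddf0 !row_mx0.
pose c := u^T *m invmx K.
have cK : (c *m K)^T = u by rewrite /c mulmxKV// trmxK.
exists (lsubmx c); have := KE c.
by rewrite -cr -cN cK ur uN !scale0r !addr0.
Qed.

End TangentPlane.

(** * Tangent Killing fields preserve the surface *)

Section KillingInvariance.
Context {R : realType}.
Variables (rho N : 'rV[R]_2 -> 'cV[R]_4) (B : 'M[R]_4).
Hypotheses (hrho : immersion_S3 rho) (hN : gauss_map rho N) (skB : skew_mx B).
Hypothesis fB0 : forall m, fB rho N B m = 0.
Let E (t : R) := expmx (t *: B).

Lemma continuous_dot_rho (z : 'cV[R]_4) : continuous (fun m => dot z (rho m)).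
Proof.
have [sr _ _ _] := hrho.
rewrite (_ : (fun m => _) = \sum_i (fun m => z i 0 * rho m i 0)); last first.
  by apply/funext => y; rewrite dotE fct_sumE.
elim/big_ind: _ => [|f g cf cg|i _] m; first exact: (@cst_continuous _ _ (0 : R)).
  exact: cvgD (cf m) (cg m).
have cm : {for m, continuous (fun y => rho y i 0)}.
  exact: (@continuous_entry _ _ _ _ rho i 0 (smooth_continuous sr) m).
exact: (cvgMl_tmp cm).
Qed.

(** At a point [m] maximising [<z, rho>], the tangent vector [B (rho m)] is
    orthogonal to [z]; moving [z] by the flow therefore changes [<z, rho m>]
    by a term of higher order only. *)
Lemma flow_dot_step e : 0 < e -> exists2 d, 0 < d & forall z m h,
  dot z z = 1 -> (forall y, dot z (rho y) <= dot z (rho m)) -> `|h| < d ->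
  dot z (rho m) - e * `|h| <= dot (E h *m z) (rho m).
Proof.
move=> e0; have [sr _ r1 _] := hrho.
(* 16 = 4 * 4: one factor for the product with a matrix, one for [dot] *)
have [d d0 hd] := expmx_first_order B (divr_gt0 e0 (ltr0n R 16 : 0 < 16%:R)).
exists d => // z m h z1 zmax /hd {}hd.
have zB : dot (B *m z) (rho m) = 0.
  rewrite dot_skew//; have [||v ->] := @tangent_vector _ rho N hrho hN m (B *m rho m).
  - exact: dot_skew0.
  - exact: fB0.
  have hv y : is_derive y v (fun m => dot z (rho m)) (dot z ('d rho y v)).
    have h1 := derivableP (smooth_derivable y v sr).
    apply: (is_derive_eq (is_derive_dot (is_derive_const z y v) h1)).
    by rewrite dot0l add0r (deriveE v (smooth_diff y sr)).
  have := is_derive_val (hv m) (derive_at_max (fun y => @ex_derive _ _ _ _ _ _ _ (hv y)) zmax).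
  by rewrite dotC => ->; rewrite oppr0.
pose D := E h - 1%:M - h *: B.
have ED : E h = 1%:M + h *: B + D.
  by rewrite /D -[E h - _ - _]addrA -opprD subrKC.
have {}hd : `|D| <= e / 16%:R * `|h| by [].
rewrite ED; move: D hd {ED} => D hd.
rewrite !mulmxDl mul1mx -scalemxAl !dot_lin zB mulr0 addr0 lerD2l.
rewrite lerNl (le_trans (ler_norm _))// normrN (le_trans (dot_norm_le _ _))//.
have Dz : `|D *m z| <= 4%:R * (e / 16%:R * `|h|).
  rewrite (le_trans (mx_norm_mul _ _))// -mulrA ler_wpM2l//.
  by rewrite -[leRHS]mulr1 ler_pM//; exact: unit_norm_le1.
have rm : `|rho m| <= 1 by exact: unit_norm_le1.
apply: le_trans (ler_wpM2l _ rm) _; first by rewrite mulr_ge0.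
rewrite mulr1; apply: le_trans (ler_wpM2l _ Dz) _; first exact: ler0n.
by lra.
Qed.

(** Cutting [0, t] into [n] small steps, the maximum over the torus of
    [<e^{sB} x, rho>], which is one at [s = 0], loses at most [e] in total. So
    it is one at [s = t] as well, and a maximiser is mapped to [e^{tB} x]. *)
Lemma flow_preserves_range t x : range rho x -> range rho (E t *m x).
Proof.
move=> [m0 _ <-]; have [sr tr r1 _] := hrho.
have Edot s : dot (E s *m rho m0) (E s *m rho m0) = 1 by rewrite dot_expmx.
have exmax z : exists m, forall y, dot z (rho y) <= dot z (rho m).
  apply: torus_max; first exact: continuous_dot_rho.
  by move=> y k; rewrite tr.
have [m mmax] := exmax (E t *m rho m0).
exists m => //; apply: esym; apply: dot_unit_eq => //.
apply/ler_addgt0Pr => e e0.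
have K0 : 0 < `|t| + 1 by rewrite ltr_wpDl.
have [d d0 hd] := flow_dot_step (divr_gt0 e0 K0).
pose n := (Num.truncn (`|t| / d)).+1.
have n0 : 0 < n%:R :> R by rewrite ltr0n.
have hn : `|t / n%:R| < d.
  rewrite normrM normfV normr_nat ltr_pdivrMr// mulrC -ltr_pdivrMr//.
  by rewrite /n truncnS_gt.
have step k : exists p, 1 - k%:R * (e / (`|t| + 1) * `|t / n%:R|) <=
    dot (E (k%:R * (t / n%:R)) *m rho m0) (rho p).
  elim: k => [|k [p hp]].
    by exists m0; rewrite !mul0r subr0 /E expmx0 mul1mx r1.
  have [q hq] := exmax (E (k%:R * (t / n%:R)) *m rho m0).
  exists q; have := hd _ _ _ (Edot _) hq hn.
  have kS : k.+1%:R = 1 + k%:R :> R by rewrite -natr1 addrC.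
  have -> : E (k.+1%:R * (t / n%:R)) = E (t / n%:R) *m E (k%:R * (t / n%:R)).
    by rewrite kS mulrDl mul1r; exact: expmxD.
  rewrite -mulmxA; apply: le_trans.
  rewrite kS [(1 + _) * _]mulrDl mul1r opprD addrCA [leLHS]addrC lerD2r.
  exact: le_trans hp (hq p).
have nt : n%:R * `|t / n%:R| = `|t|.
  by rewrite normrM normfV normr_nat mulrCA mulfV ?mulr1// gt_eqF.
have tn : n%:R * (t / n%:R) = t by rewrite mulrCA mulfV ?mulr1// gt_eqF.
have [p] := step n; rewrite tn mulrCA nt => hp.
rewrite -lerBlDr; apply: le_trans (mmax p); apply: le_trans hp.
by rewrite lerD2l lerN2 mulrAC ler_pdivrMr// ler_wpM2l ?lerDl// ltW.
Qed.

Lemma flow_range t : [set E t *m x | x in range rho] = range rho.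
Proof.
apply/seteqP; split=> [_ [x xr <-]|x xr]; first exact: flow_preserves_range.
exists (E (- t) *m x); first exact: flow_preserves_range.
by rewrite mulmxA /E expmxN// mul1mx.
Qed.

End KillingInvariance.

(** * Nullity at most five *)

Section NaturalNullity.
Context {R : realType}.
Variables (rho N : 'rV[R]_2 -> 'cV[R]_4) (a : 'rV[R]_2 -> R)
  (W1 W2 : 'rV[R]_2 -> 'rV[R]_2).

Definition fB_coord (c : 'rV[R]_6) : 'rV[R]_2 -> R := fB rho N (skew_of c).

Lemma fB_coord_is_linear : linear fB_coord.
Proof.
move=> k b c; apply/funext => m; rewrite /fB_coord /fB linearP mulmxDl.
by rewrite -scalemxAl dotDl dotZl.
Qed.

HB.instance Definition _ := GRing.isLinear.Build R 'rV[R]_6 ('rV[R]_2 -> R) _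
  fB_coord fB_coord_is_linear.

(** The six functions [f_B] of a basis of [so(4)] lie in [NS], so nullity at
    most five makes them dependent, and a dependency is a single [B]. *)
Lemma nnt_le5_fB_eq0 : (nnt rho N a W1 W2 <= 5%:E)%E ->
  exists B, [/\ skew_mx B, B != 0 & forall m, fB rho N B m = 0].
Proof.
move=> n5; apply: contrapT => noB.
have inj c : fB_coord c = 0 -> c = 0.
  move=> fc; apply: contrapT => /eqP c0; apply: noB; exists (skew_of c).
  split=> [||m]; first exact: skew_of_skew.
    by rewrite -(inj_eq (can_inj skew_ofK)) linear0 in c0.
  exact: (congr1 (@^~ m) fc).
have : (6%:R%:E <= nnt rho N a W1 W2)%E.
  apply: (@lin_dim_ge _ _ _ _ (fun i => fB_coord (delta_mx 0 i))).
    move=> c; have -> : \sum_i c i *: fB_coord (delta_mx 0 i) =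
        fB_coord (\row_i c i).
      rewrite (row_sum_delta (\row_i c i)) linear_sum; apply: eq_bigr => i _.
      by rewrite linearZ_LR mxE.
    by move=> /inj/rowP h i; have := h i; rewrite !mxE.
  move=> i; exists (skew_of (delta_mx 0 i)), 0, 0; split; first exact: skew_of_skew.
  by apply/funext => m; rewrite mul0r addr0.
move=> /le_trans/(_ n5); rewrite lee_fin; lra.
Qed.

Lemma nnt_le5_hsiang_lawson : immersion_S3 rho -> gauss_map rho N ->
  (nnt rho N a W1 W2 <= 5%:E)%E -> hsiang_lawson rho.
Proof.
move=> hrho hN /nnt_le5_fB_eq0[B [skB B0 f0]].
by exists B; split=> // t; exact: (flow_range hrho hN).
Qed.

(** Under these hypotheses [NS] is the image of [so(4)], of dimension six, by a
    linear map with a nonzero kernel. *)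
Lemma nnt_le5 (B : 'M[R]_4) : skew_mx B -> B != 0 ->
  (forall m, fB rho N B m = 0) ->
  (forall g, NS rho N a W1 W2 g -> exists2 B', skew_mx B' & g = fB rho N B') ->
  (nnt rho N a W1 W2 <= 5%:E)%E.
Proof.
move=> skB B0 f0 hNS; apply: (@lin_dim_le _ _ _ 5) => n b ib bS.
rewrite -ltnS; apply: (@lin_indep_image_lt _ _ _ fB_coord (skew_coord B) n b) => //.
- apply: contraNneq B0 => c0; rewrite -(skew_coordK skB) c0 linear0//.
- by apply/funext => m; rewrite /= /fB_coord (skew_coordK skB) f0.
move=> i; have [B' skB' ->] := hNS _ (bS i).
by exists (skew_coord B'); rewrite /= /fB_coord (skew_coordK skB').
Qed.

End NaturalNullity.

(** * First-order estimates *)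

Section Estimates.
Context {R : realType}.
Let P := 'rV[R]_2.

(** The mean value inequality for [f - A], where [A] is the linear map with
    columns [A_j]. With [A] the differential of [f] at a point it gives strict
    differentiability there, and with [A = 0] a Lipschitz bound. *)
Lemma segment_estimate n (f : P -> 'cV[R]_n) (A : 'I_2 -> 'cV[R]_n) e (x y : P) :
  smooth f -> 0 <= e ->
  (forall s j, 0 <= s <= 1 ->
    `|'D_(delta_mx 0 j) f (y + s *: (x - y)) - A j| <= e) ->
  `|f x - f y - \sum_j (x - y) 0 j *: A j| <= 2 * e * `|x - y|.
Proof.
move=> sf e0 hA; apply: mx_norm_le => [|i k]; first by rewrite !mulr_ge0.
have dfe z : derivable (fun y => f y i k) z (x - y).
  by have /derivable_mxP/(_ i k) := smooth_derivable z (x - y) sf.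
have [s s01] := @MVT_line _ _ (fun z => f z i k) y (x - y) 1 ler01 dfe.
rewrite scale1r subrKC mul1r derive_entry; last exact: smooth_derivable.
rewrite (derive_coordE _ (x - y) sf) summxE => fxy.
have -> : (f x - f y - \sum_j (x - y) 0 j *: A j) i k =
    f x i k - f y i k - (\sum_j (x - y) 0 j *: A j) i k by rewrite !mxE.
rewrite fxy summxE -sumrB.
rewrite (le_trans (ler_norm_sum _ _ _))// -mulrA mulr_natl.
rewrite -[X in _ *+ X]card_ord -sumr_const; apply: ler_sum => j _.
rewrite [(_ *: 'D_(_) f _) i k]mxE [(_ *: A j) i k]mxE.
rewrite -mulrBr normrM mulrC ler_pM//.
  apply: le_trans (hA s j s01); apply: le_trans (mx_entry_le _ i k).
  by rewrite !mxE.
exact: mx_entry_le.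
Qed.

Lemma strict_differentiability n (f : P -> 'cV[R]_n) m e : smooth f -> 0 < e ->
  exists2 d, 0 < d & forall x y, `|x - m| < d -> `|y - m| < d ->
    `|f x - f y - 'D_(x - y) f m| <= e * `|x - y|.
Proof.
move=> sf e0; have e20 : 0 < e / 2 by rewrite divr_gt0.
have cD j : continuous ('D_(delta_mx 0 j) f).
  exact: smooth_continuous (smooth_derive _ sf).
have /nbhs_ballP[d /= d0 hd] : \forall z \near m, forall j : 'I_2,
    `|'D_(delta_mx 0 j) f m - 'D_(delta_mx 0 j) f z| <= e / 2.
  apply: (@filter_forall _ _ (fun j z =>
    `|'D_(delta_mx 0 j) f m - 'D_(delta_mx 0 j) f z| <= e / 2) (nbhs m) _) => j.
  by have /cvgrPdist_le/(_ _ e20) := cD j m.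
exists d => // x y xm ym.
rewrite (derive_coordE _ (x - y) sf) -[e](divfK (_ : 2 != 0))// [_ / _ * _]mulrC.
apply: segment_estimate => // [|s j /andP[s0 s1]]; first exact: ltW.
rewrite distrC; apply: hd; rewrite -ball_normE /= distrC.
have -> : y + s *: (x - y) - m = s *: (x - m) + (1 - s) *: (y - m).
  by apply/rowP => k; rewrite !mxE; ring.
have s1' : 0 <= 1 - s by rewrite subr_ge0.
rewrite (le_lt_trans (ler_normD _ _))// !normrZ (ger0_norm s0) (ger0_norm s1').
have [->|sn0] := eqVneq s 0; first by rewrite mul0r add0r subr0 mul1r.
have : s * `|x - m| < s * d by rewrite ltr_pM2l// lt_def sn0.
have : (1 - s) * `|y - m| <= (1 - s) * d by rewrite ler_wpM2l// ltW.
by lra.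
Qed.

Lemma lipschitz_unit_square n (f : P -> 'cV[R]_n) : smooth f ->
  exists2 L, 0 < L & forall x y, unit_square x -> unit_square y ->
    `|f x - f y| <= L * `|x - y|.
Proof.
move=> sf.
have bnd j : exists M, forall z, unit_square z -> `|'D_(delta_mx 0 j) f z| <= M.
  have cD : continuous (fun z => `|'D_(delta_mx 0 j) f z|).
    move=> z.
    have cz := @smooth_continuous _ _ _ _ (smooth_derive (delta_mx 0 j) sf) z.
    exact: (cvg_norm cz).
  have [||c _ hc] := @EVT_max_rV R 2 (fun z => `|'D_(delta_mx 0 j) f z|)
    unit_square _ compact_unit_square.
  - by exists 0 => i; rewrite mxE in_itv /= lexx ler01.
  - exact: continuous_subspaceT.
  by exists `|'D_(delta_mx 0 j) f c| => z zQ; apply: hc; rewrite inE.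
have [M0 h0] := bnd 0; have [M1 h1] := bnd 1.
pose M := `|M0| + `|M1| + 1.
have n0 := normr_ge0 M0; have n1 := normr_ge0 M1.
have hM j z : unit_square z -> `|'D_(delta_mx 0 j) f z| <= M.
  move=> zQ; case: (unliftP 0 j) => [j' ->|->].
    rewrite (_ : lift 0 j' = 1); last by apply/val_inj; case: j' => -[].
    by apply: le_trans (h1 z zQ) _; rewrite (le_trans (ler_norm _))// /M; lra.
  by apply: le_trans (h0 z zQ) _; rewrite (le_trans (ler_norm _))// /M; lra.
have M0' : 0 < M by rewrite ltr_wpDl// addr_ge0.
exists (2 * M) => [|x y xQ yQ]; first by rewrite mulr_gt0.
have := @segment_estimate _ f (fun=> 0) M x y sf (ltW M0').
rewrite big1 ?subr0 => [|j _]; last by rewrite scaler0.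
apply=> s j /andP[s0 s1]; rewrite subr0; apply: hM => i.
have := xQ i; have := yQ i; rewrite /= !in_itv /= !mxE.
move=> /andP[y0 y1] /andP[x0 x1]; apply/andP; split; nra.
Qed.

Lemma orthogonal_norm_le1 n (A : 'M[R]_n) : A^T *m A = 1%:M -> `|A| <= 1.
Proof.
move=> AA; apply: mx_norm_le => // i j.
have -> : A i j = col j A i 0 by rewrite mxE.
apply: unit_entry_le1; transitivity ((1%:M : 'M[R]_n) j j).
  by rewrite -AA dotE mxE; apply: eq_bigr => k _; rewrite !mxE.
by rewrite mxE eqxx.
Qed.

Lemma immersion_lower_bound (rho : P -> 'cV[R]_4) m : immersion_S3 rho ->
  exists2 k, 0 < k & forall w, `|w| <= k * `|'d rho m w|.
Proof.
move=> [_ _ _ inj].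
pose J := jacobian rho m; have JE := jacobianE rho m.
have /row_freeP[K JK] : row_free J.
  rewrite -kermx_eq0; apply/eqP/row_matrixP => i; rewrite row0.
  by apply: (inj m); rewrite -JE -row_mul mulmx_ker row0 trmx0 linear0.
exists (4%:R * (`|K| + 1)) => [|w]; first by rewrite mulr_gt0// ltr_wpDl.
rewrite -{1}[w]mulmx1 -JK mulmxA (le_trans (mx_norm_mul _ _))// -!mulrA.
rewrite ler_wpM2l// mulrC ler_pM ?lerDl//.
apply: mx_norm_le => // i j.
have -> : (w *m J) i j = 'd rho m w j i by rewrite -JE [RHS]mxE.
exact: mx_entry_le.
Qed.

End Estimates.

(** * Killing fields preserving the surface are tangent to it *)

Section Transversality.
Context {R : realType}.
Let P := 'rV[R]_2.
Variables (rho N : P -> 'cV[R]_4) (B : 'M[R]_4).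
Hypotheses (hrho : immersion_S3 rho) (hN : gauss_map rho N) (skB : skew_mx B).
Let E (t : R) := expmx (t *: B).

(** The linear map on the right is the differential at [(0, m)] of
    [(t, x) |-> e^{tB} (rho x)]. It is injective because [B (rho m)] is not
    tangent: the component along [N m] controls [t], and then the immersion
    controls [w]. *)
Lemma transverse_lower_bound m : fB rho N B m != 0 -> exists2 C, 0 < C &
  forall (t : R) w, `|t| + `|w| <= C * `|t *: (B *m rho m) + 'd rho m w|.
Proof.
move=> f0; have [k k0 hk] := immersion_lower_bound m hrho.
have [_ _ N1 _ Nd] := hN.
pose f := `|fB rho N B m|; have {}f0 : 0 < f by rewrite normr_gt0.
pose b := `|B *m rho m|; have b0 : 0 <= b by exact: normr_ge0.
have C0 : 0 < 4 / f * (1 + k * b) + k.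
  by rewrite ltr_wpDl// !mulr_ge0 ?invr_ge0 ?addr_ge0 ?mulr_ge0// ltW.
exists (4 / f * (1 + k * b) + k) => // t w; set u := t *: _ + _.
have tu : `|t| <= 4 / f * `|u|.
  rewrite mulrAC ler_pdivlMr// /f -normrM.
  have -> : t * fB rho N B m = dot u (N m).
    by rewrite /u dotDl dotZl [dot ('d _ _ _) _]dotC Nd addr0.
  rewrite (le_trans (dot_norm_le _ _))// -[leRHS]mulr1 ler_wpM2l ?mulr_ge0//.
  exact: unit_norm_le1.
have wu : `|w| <= k * (`|u| + `|t| * b).
  apply: le_trans (hk w) _; rewrite ler_wpM2l ?(ltW k0)//.
  have -> : 'd rho m w = u - t *: (B *m rho m) by rewrite /u addrC addKr.
  by rewrite (le_trans (ler_normB _ _))// normrZ.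
apply: le_trans (lerD (lexx _) wu) _.
have -> : `|t| + k * (`|u| + `|t| * b) = `|t| * (1 + k * b) + k * `|u| by ring.
rewrite mulrDl lerD2r mulrAC ler_wpM2r// addr_ge0// mulr_ge0//; exact: ltW.
Qed.

(** [e^{tB} (rho x) - rho y] differs from its linearisation at [m] by a small
    multiple of [|t| + |x - y|], which the lower bound absorbs. *)
Lemma flow_separation m : fB rho N B m != 0 ->
  exists c d, [/\ 0 < c, 0 < d & forall t x y,
    `|t| < d -> `|x - m| < d -> `|y - m| < d ->
    c * (`|t| + `|x - y|) <= `|E t *m rho x - rho y|].
Proof.
move=> f0; have [C C0 hC] := transverse_lower_bound f0.
have [sr _ r1 _] := hrho.
(* the three error terms below add up to 5 e, half of the lower bound 1 / C *)
pose e := (10 * C)^-1.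
have e0 : 0 < e by rewrite invr_gt0 mulr_gt0.
have [d1 d10 h1] := expmx_first_order B e0.
have [d2 d20 h2] := strict_differentiability m sr e0.
have K0 : 0 < 4 * `|B| + 1 by rewrite ltr_wpDl// mulr_ge0.
have /cvgrPdist_le/(_ _ (divr_gt0 e0 K0))/nbhs_ballP[d3 /= d30 h3] :=
  smooth_continuous sr (x := m).
pose d := Num.min d1 (Num.min d2 d3).
have [dd1 dd2 dd3] : [/\ d <= d1, d <= d2 & d <= d3].
  by split; rewrite /d !ge_min lexx ?orbT.
exists (2 * C)^-1, d; split; [by rewrite invr_gt0 mulr_gt0 | by rewrite !lt_min d10 d20 |].
move=> t x y td xd yd.
set u := t *: (B *m rho m) + 'd rho m (x - y).
pose D := E t - 1%:M - t *: B.
have hD : `|D| <= e * `|t| by apply: h1; exact: lt_le_trans td dd1.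
pose r2 := t *: (B *m (rho x - rho m)).
pose r3 := rho x - rho y - 'd rho m (x - y).
have -> : E t *m rho x - rho y = u + (D *m rho x + r2 + r3).
  rewrite /u /D /r2 /r3 !mulmxBl mul1mx mulmxBr scalerBr -scalemxAl.
  by apply/matrixP => i j; rewrite !mxE; ring.
have n1 : `|D *m rho x| <= 4 * e * `|t|.
  rewrite (le_trans (mx_norm_mul _ _))// -!mulrA ler_wpM2l//.
  by rewrite -[leRHS]mulr1 ler_pM//; exact: unit_norm_le1.
have n2 : `|r2| <= e * `|t|.
  rewrite /r2 normrZ mulrC ler_wpM2r// (le_trans (mx_norm_mul _ _))//.
  have /h3 : ball m d3 x.
    by rewrite -ball_normE /= distrC (lt_le_trans xd).
  rewrite distrC ler_pdivlMr// mulrC => h; apply: le_trans h.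
  by rewrite ler_wpM2r// lerDl.
have n3 : `|r3| <= e * `|x - y|.
  rewrite /r3 -(deriveE _ (smooth_diff m sr)); apply: h2; exact: lt_le_trans dd2.
have n : `|D *m rho x + r2 + r3| <= 5 * e * (`|t| + `|x - y|).
  rewrite (le_trans (ler_normD _ _))//; apply: le_trans (lerD (ler_normD _ _) n3) _.
  have := normr_ge0 (x - y); have := normr_ge0 t; move: n1 n2; nra.
have := hC t (x - y); rewrite -/u => hu.
have := lerB_normD u (D *m rho x + r2 + r3); move: n.
move: (`|_ + (_ + _ + _)|) (`|_ + _ + _|) => A V VE.
rewrite [_ * (_ + _)]mulrC ler_pdivrMr ?mulr_gt0//.
move: VE; rewrite /e invfM => VE AV.
have {}VE : 2 * C * V <= `|t| + `|x - y|.
  have C20 : 0 < 2 * C by rewrite mulr_gt0.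
  apply: le_trans (ler_wpM2l (ltW C20) VE) _.
  have Cn : C != 0 by rewrite gt_eqF.
  by rewrite le_eqVlt; apply/orP; left; apply/eqP; field.
move: (ler_wpM2l (ltW C0) AV).
by lra.
Qed.

(** With [n = (M + 1)^2 + 1] one has [(M n + 1)^2 <= (M + 1)^2 n^2 < n^3]. *)
Lemma card_box_lt M : exists n, ((M * n).+1 ^ 2 < n ^ 3)%N.
Proof.
exists ((M.+1 ^ 2).+1); set n := (M.+1 ^ 2).+1.
apply: (@leq_ltn_trans ((M.+1 * n) ^ 2)).
  by rewrite leq_exp2r// mulSn -addn1 addnC leq_add2r.
by rewrite expnMn (expnSr n 2) mulnC ltn_pmul2l// expn_gt0.
Qed.

(** If [f_B m] were nonzero, the [n^3] points [e^{t_k B} (rho x_ij)] of a cubic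
    grid of mesh [h / n] around [(0, m)] would be at mutual distance at least
    [c h / n]. They lie in the range of [rho], which is the image by a
    Lipschitz map of the unit square, hence is covered by about [M^2 n^2] sets
    of smaller diameter. For large [n] two points share one of these sets. *)
Lemma invariant_range_fB_eq0 m :
  (forall t, [set E t *m x | x in range rho] `<=` range rho) ->
  fB rho N B m = 0.
Proof.
move=> inv; apply/eqP/negPn/negP => /flow_separation[c [d [c0 d0 sep]]].
have [sr tr r1 _] := hrho.
have [L L0 hL] := lipschitz_unit_square sr.
pose h := d / 2; have h0 : 0 < h by rewrite divr_gt0.
have hd : h < d by rewrite /h; lra.
pose M := (Num.truncn (4 * L / (c * h))).+1.
have hM : 4 * L / (c * h) < M%:R by rewrite /M truncnS_gt.
have [n hn] := card_box_lt M.
have n0 : (0 < n)%N by case: n hn.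
have nR : 0 < n%:R :> R by rewrite ltr0n.
pose st (k : 'I_n) : R := h * (k%:R / n%:R).
have st01 (k : 'I_n) : 0 <= (k%:R / n%:R : R) <= 1.
  by rewrite divr_ge0//= ler_pdivrMr// mul1r ler_nat ltnW.
have std k k' : `|st k - st k'| < d.
  apply: le_lt_trans hd; rewrite /st -mulrBr normrM gtr0_norm//.
  have /andP[k0 k1] := st01 k; have /andP[k0' k1'] := st01 k'.
  by rewrite ger_pMr// ler_norml; apply/andP; split; lra.
have stn k k' : k != k' -> h / n%:R <= `|st k - st k'|.
  move=> kk'; have -> : st k - st k' = h / n%:R * (k%:R - k'%:R).
    by rewrite /st; ring.
  have hn0 : 0 < h / n%:R by rewrite divr_gt0.
  rewrite normrM gtr0_norm// -[leLHS]mulr1 ler_wpM2l ?(ltW hn0)//.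
  have := kk'; rewrite -val_eqE /= neq_ltn.
  rewrite ler_normr; case/orP; rewrite -(ler_nat R) -natr1 => kk; apply/orP.
    by right; lra.
  by left; lra.
pose x (i j : 'I_n) : P := m + \row_l (if l == 0 then st i else st j).
have xd i j : `|x i j - m| < d.
  apply: le_lt_trans hd; rewrite /x addrC addKr; apply: mx_norm_le => [|? l].
    exact: ltW.
  have sth k : `|st k| <= h.
    rewrite /st normrM gtr0_norm//; have /andP[k0 k1] := st01 k.
    by rewrite ger_pMr// ger0_norm.
  by rewrite mxE; case: ifP.
have xn i j i' j' : (i, j) != (i', j') -> h / n%:R <= `|x i j - x i' j'|.
  move=> ij; have xE l : (x i j - x i' j') 0 l =
      (if l == 0 then st i - st i' else st j - st j').
    by rewrite !mxE; case: ifP => _; ring.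
  have [ii|ii] := eqVneq i i'; last first.
    by apply: le_trans (stn _ _ ii) _; have /= <- := xE 0; exact: mx_entry_le.
  have jj : j != j' by move: ij; rewrite ii; apply: contraNneq => ->.
  by apply: le_trans (stn _ _ jj) _; have /= <- := xE 1; exact: mx_entry_le.
have /choice[y hy] (p : 'I_n * 'I_n * 'I_n) :
    exists y, unit_square y /\ rho y = E (st p.2) *m rho (x p.1.1 p.1.2).
  have [|z _ <-] := inv (st p.2) (E (st p.2) *m rho (x p.1.1 p.1.2)).
    by exists (rho (x p.1.1 p.1.2)) => //; exists (x p.1.1 p.1.2).
  by have [y yQ <-] := torus_reduce z tr; exists y.
pose box (v : P) (l : 'I_2) : 'I_(M * n).+1 := inord (Num.truncn (v 0 l * (M * n)%:R)).
have Mn0 : 0 < (M * n)%:R :> R by rewrite ltr0n muln_gt0.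
have boxP v w : unit_square v -> unit_square w -> box v =1 box w ->
    `|v - w| <= (M * n)%:R^-1.
  move=> vQ wQ vw; apply: mx_norm_le => [|i l]; first by rewrite invr_ge0.
  have trE u : unit_square u -> (box u l)%:R <= u 0 l * (M * n)%:R < (box u l)%:R + 1.
    move=> /(_ l); rewrite /= in_itv /= => /andP[u0 u1].
    have u0' : 0 <= u 0 l * (M * n)%:R by rewrite mulr_ge0.
    have /andP[t1 t2] := Num.Theory.truncn_itv u0'.
    rewrite /box inordK ?t1 ?natr1// ltnS -(ler_nat R) (le_trans t1)//.
    by rewrite ler_piMl.
  have := trE v vQ; have := trE w wQ; rewrite (vw l).
  move=> /andP[w1 w2] /andP[v1 v2].
  rewrite ord1 -[leRHS]div1r ler_pdivlMr// -[X in _ * X]gtr0_norm// -normrM.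
  by rewrite !mxE mulrDl mulNr ler_norml; apply/andP; split; lra.
have : injective (fun p => (box (y p) 0, box (y p) 1)).
  move=> p p' [b0 b1]; have [//|pp] := eqVneq p p'; exfalso.
  have bb : box (y p) =1 box (y p').
    move=> l; case: (unliftP 0 l) => [l' ->|->]; last exact: b0.
    by rewrite (_ : lift 0 l' = 1)//; apply/val_inj; case: l' => -[].
  have [yQ ry] := hy p; have [yQ' ry'] := hy p'.
  have far : h / n%:R <= `|st p.2 - st p'.2| + `|x p.1.1 p.1.2 - x p'.1.1 p'.1.2|.
    have [ee|ne] := eqVneq p.2 p'.2; last by rewrite ler_wpDr// stn.
    rewrite ler_wpDl// xn//; apply: contraNneq pp => e1.
    by case: p p' e1 ee {b0 b1 bb yQ ry yQ' ry'} => [[? ?] ?] [[? ?] ?] /= [-> ->] ->.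
  have near : `|E (st p.2 - st p'.2) *m rho (x p.1.1 p.1.2) -
      rho (x p'.1.1 p'.1.2)| <= 4 * L / (M * n)%:R.
    have -> : E (st p.2 - st p'.2) *m rho (x p.1.1 p.1.2) - rho (x p'.1.1 p'.1.2) =
        E (- st p'.2) *m (rho (y p) - rho (y p')).
      have -> : E (st p.2 - st p'.2) = E (- st p'.2) *m E (st p.2).
        by rewrite addrC; exact: expmxD.
      have E1 : E (- st p'.2) *m E (st p'.2) = 1%:M.
        by rewrite /E -expmxD// addNr expmx0.
      by rewrite mulmxBr ry ry' !mulmxA E1 mul1mx.
    rewrite (le_trans (mx_norm_mul _ _))// -!mulrA ler_wpM2l//.
    rewrite -[leRHS]mul1r ler_pM//; first exact/orthogonal_norm_le1/expmx_orthogonal.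
    by rewrite (le_trans (hL _ _ yQ yQ'))// ler_wpM2l ?boxP// ltW.
  have := sep _ _ _ (std p.2 p'.2) (xd p.1.1 p.1.2) (xd p'.1.1 p'.1.2).
  move=> /le_trans/(_ near) cL.
  have : c * (h / n%:R) <= 4 * L / (M * n)%:R.
    by apply: le_trans cL; rewrite ler_wpM2l ?(ltW c0).
  rewrite ler_pdivlMr// natrM.
  have -> : c * (h / n%:R) * (M%:R * n%:R) = M%:R * (c * h).
    by field; rewrite gt_eqF.
  by rewrite -ler_pdivlMr ?mulr_gt0// leNgt hM.
move=> /leq_card; rewrite !card_prod !card_ord => hc.
by have := leq_ltn_trans hc hn; rewrite !expnS !expn0 !muln1 mulnA ltnn.
Qed.

End Transversality.

(** * Moving frames and structure equations *)

Section Gateaux.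
Context {R : realType} {V W : normedModType R}.

(** Linearity in the direction is what lets a derivative be computed along the
    vectors of a frame only; unlike differentiability it is read off directly
    from the formulas for derivatives of frames and inner products. *)
Definition gateaux (f : V -> W) (x : V) := exists l : V -> W,
  (forall c c' v v', l (c *: v + c' *: v') = c *: l v + c' *: l v') /\
  forall v, is_derive x v f (l v).

Lemma gateaux_derivable f x v : gateaux f x -> derivable f x v.
Proof. by move=> [l [_ h]]; case: (h v). Qed.

Lemma gateaux_is_derive f x v : gateaux f x -> is_derive x v f ('D_v f x).
Proof. by move=> h; apply/derivableP/gateaux_derivable. Qed.

Lemma gateaux_comb f x c c' v v' d d' : gateaux f x ->
  is_derive x v f d -> is_derive x v' f d' ->
  is_derive x (c *: v + c' *: v') f (c *: d + c' *: d').
Proof.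
move=> [l [hl h]] hd hd'.
by rewrite (is_derive_val hd (h v)) (is_derive_val hd' (h v')) -hl; exact: h.
Qed.

Lemma gateaux_diff f x : differentiable f x -> gateaux f x.
Proof.
move=> df; exists (fun v => 'D_v f x); split=> [c c' v v'|v].
  by rewrite (deriveDr _ _ df) (deriveZr _ _ df) (deriveZr _ _ df).
by apply: derivableP; exact: diff_derivable.
Qed.

End Gateaux.

Arguments gateaux_derivable {R V W f x} v.
Arguments gateaux_is_derive {R V W f x} v.

(** The first-order relations between a minimal immersion [rho], its normal
    [N], its principal curvature [a] and the images [e1], [e2] of a principal
    frame. Orthogonality of [e1] and [e2] is asserted away from umbilic points
    only. The last clause is the Codazzi equation: [x12 - x21] is the
    differential of [rho] at the bracket of [W1] and [W2], and [z] is the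
    differential of [N] there. *)
Record adapted_frame {R : realType} (rho N e1 e2 : 'rV[R]_2 -> 'cV[R]_4)
  (a : 'rV[R]_2 -> R) (W1 W2 : 'rV[R]_2 -> 'rV[R]_2) : Prop := AdaptedFrame {
  af_rho_rho : forall y, dot (rho y) (rho y) = 1;
  af_N_N : forall y, dot (N y) (N y) = 1;
  af_11 : forall y, dot (e1 y) (e1 y) = 1;
  af_22 : forall y, dot (e2 y) (e2 y) = 1;
  af_N_rho : forall y, dot (N y) (rho y) = 0;
  af_1_rho : forall y, dot (e1 y) (rho y) = 0;
  af_2_rho : forall y, dot (e2 y) (rho y) = 0;
  af_1_N : forall y, dot (e1 y) (N y) = 0;
  af_2_N : forall y, dot (e2 y) (N y) = 0;
  af_a12 : forall y, a y * dot (e1 y) (e2 y) = 0;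
  af_rho1 : forall y, is_derive y (W1 y) rho (e1 y);
  af_rho2 : forall y, is_derive y (W2 y) rho (e2 y);
  af_N1 : forall y, is_derive y (W1 y) N (- a y *: e1 y);
  af_N2 : forall y, is_derive y (W2 y) N (a y *: e2 y);
  af_d_rho : forall y, gateaux rho y;
  af_d_N : forall y, gateaux N y;
  af_d_e1 : forall y, gateaux e1 y;
  af_d_e2 : forall y, gateaux e2 y;
  af_d_a : forall y, gateaux a y;
  af_span : forall y v, 0 < a y -> exists c1 c2, v = c1 *: W1 y + c2 *: W2 y;
  af_codazzi : forall y x12 x21 d1 d2,
    is_derive y (W1 y) e2 x12 -> is_derive y (W2 y) e1 x21 ->
    is_derive y (W1 y) a d1 -> is_derive y (W2 y) a d2 ->
    let z := (d1 *: e2 y + a y *: x12) + (d2 *: e1 y + a y *: x21) in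
    dot z (e1 y) = - a y * dot (x12 - x21) (e1 y) /\
    dot z (e2 y) = a y * dot (x12 - x21) (e2 y)
}.

Section StructureEquations.
Context {R : realType}.
Let P := 'rV[R]_2.
Variables (rho N e1 e2 : P -> 'cV[R]_4) (a : P -> R) (W1 W2 : P -> P).
Hypothesis hF : adapted_frame rho N e1 e2 a W1 W2.

Lemma dot_frame y : 0 < a y -> dot (e1 y) (e2 y) = 0.
Proof.
move=> a0; have /eqP := af_a12 hF y.
by rewrite mulf_eq0 (gt_eqF a0) /= => /eqP.
Qed.

Lemma frame_expand y u : 0 < a y ->
  u = dot u (rho y) *: rho y + dot u (e1 y) *: e1 y + dot u (e2 y) *: e2 y +
      dot u (N y) *: N y.
Proof.
move=> a0; apply: orthonormal_expand; split.
- exact: af_rho_rho hF y.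
- exact: af_11 hF y.
- exact: af_22 hF y.
- exact: af_N_N hF y.
- by rewrite dotC; exact: af_1_rho hF y.
- by rewrite dotC; exact: af_2_rho hF y.
- by rewrite dotC; exact: af_N_rho hF y.
- exact: dot_frame.
- exact: af_1_N hF y.
- exact: af_2_N hF y.
Qed.

(** Differentiating the orthonormality relations in a direction [v] leaves one
    unknown, the rotation [<D_v e1, e2>] of the frame. *)
Lemma frame_derivative y v x1 x2 dr dn : 0 < a y ->
  is_derive y v e1 x1 -> is_derive y v e2 x2 ->
  is_derive y v rho dr -> is_derive y v N dn ->
  x1 = dot x1 (e2 y) *: e2 y - dot (e1 y) dr *: rho y - dot (e1 y) dn *: N y /\
  x2 = - dot x1 (e2 y) *: e1 y - dot (e2 y) dr *: rho y -
       dot (e2 y) dn *: N y.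
Proof.
move=> a0 h1 h2 hr hn.
have c1r := dot_const_derive (af_1_rho hF) h1 hr.
have c2r := dot_const_derive (af_2_rho hF) h2 hr.
have c1n := dot_const_derive (af_1_N hF) h1 hn.
have c2n := dot_const_derive (af_2_N hF) h2 hn.
have c11 := norm_const_derive (af_11 hF) h1.
have c22 := norm_const_derive (af_22 hF) h2.
have c12 : dot x2 (e1 y) = - dot x1 (e2 y).
  have da := gateaux_is_derive v (af_d_a hF y).
  have := is_derive_const_eq0 (af_a12 hF) (is_derive_mul da (is_derive_dot h1 h2)).
  rewrite (dot_frame a0) mulr0 add0r (dotC (e1 y)) => /eqP.
  rewrite mulf_eq0 (gt_eqF a0) /= addrC => /eqP.
  by move: (dot x2 _) (dot x1 _) => k k' ?; lra.
split.
  by rewrite {1}(frame_expand x1 a0) c1r c1n c11 scale0r addr0 !scaleNr [- _ + _]addrC.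
rewrite {1}(frame_expand x2 a0) c2r c2n c22 c12 scale0r addr0.
by move: (dot _ _) (dot _ _) (dot _ _) => k1 k2 k3; rewrite !scaleNr [- _ - _]addrC.
Qed.

(** The structure equations, with connection form [k = c1 p + c2 q]. The
    Codazzi equation expresses the derivatives of [a] through [p] and [q]. *)
Lemma structure_equations y : 0 < a y -> exists p q, forall c1 c2,
  let v := c1 *: W1 y + c2 *: W2 y in let k := c1 * p + c2 * q in
  [/\ is_derive y v rho (c1 *: e1 y + c2 *: e2 y),
      is_derive y v N (- (c1 * a y) *: e1 y + (c2 * a y) *: e2 y),
      is_derive y v e1 (k *: e2 y - c1 *: rho y + (c1 * a y) *: N y),
      is_derive y v e2 (- k *: e1 y - c2 *: rho y - (c2 * a y) *: N y) &
      is_derive y v a (2 * a y * (c2 * p - c1 * q))].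
Proof.
move=> a0.
have [r1 r2] := (af_rho1 hF y, af_rho2 hF y).
have [n1 n2] := (af_N1 hF y, af_N2 hF y).
have h11 := gateaux_is_derive (W1 y) (af_d_e1 hF y).
have h21 := gateaux_is_derive (W2 y) (af_d_e1 hF y).
have h12 := gateaux_is_derive (W1 y) (af_d_e2 hF y).
have h22 := gateaux_is_derive (W2 y) (af_d_e2 hF y).
have da1 := gateaux_is_derive (W1 y) (af_d_a hF y).
have da2 := gateaux_is_derive (W2 y) (af_d_a hF y).
move: h11 h12 h21 h22 da1 da2.
move: ('D_(W1 y) e1 y) ('D_(W1 y) e2 y) ('D_(W2 y) e1 y) ('D_(W2 y) e2 y).
move: ('D_(W1 y) a y) ('D_(W2 y) a y).
move=> d1 d2 x11 x12 x21 x22 h11 h12 h21 h22 da1 da2.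
have [E11 E12] := frame_derivative a0 h11 h12 r1 n1.
have [E21 E22] := frame_derivative a0 h21 h22 r2 n2.
have [] := af_codazzi hF h12 h21 da1 da2.
have o12 := dot_frame a0; have o21 : dot (e2 y) (e1 y) = 0 by rewrite dotC.
have u1 := af_11 hF y; have u2 := af_22 hF y.
move: E11 E12 E21 E22; rewrite !dotZr u1 u2 o12 o21.
rewrite !(mulr0, mulr1, scale0r, subr0, scale1r, scaleNr, opprK).
move: (dot x11 _) (dot x21 _) => p q E11 E12 E21 E22.
rewrite E12 E21 !dot_lin u1 u2 o12 o21 => C1 C2.
have {C1} d2E : d2 = 2 * a y * p by lra.
have {C2} d1E : d1 = - (2 * a y * q) by lra.
exists p, q => c1 c2 v k; split.
- exact: gateaux_comb (af_d_rho hF y) r1 r2.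
- apply: (is_derive_eq (gateaux_comb c1 c2 (af_d_N hF y) n1 n2)).
  by rewrite !scalerA mulrN.
- apply: (is_derive_eq (gateaux_comb c1 c2 (af_d_e1 hF y) h11 h21)).
  by rewrite E11 E21; apply/matrixP => i j; rewrite !mxE /k; ring.
- apply: (is_derive_eq (gateaux_comb c1 c2 (af_d_e2 hF y) h12 h22)).
  by rewrite E12 E22; apply/matrixP => i j; rewrite !mxE /k; ring.
- apply: (is_derive_eq (gateaux_comb c1 c2 (af_d_a hF y) da1 da2)).
  by rewrite d1E d2E /GRing.scale /=; ring.
Qed.

End StructureEquations.

(** * Tangent Killing fields in a moving frame *)

Lemma is_derive_sqrt {R : realType} {V : normedModType R} (f : V -> R) x v d :
  0 < f x -> is_derive x v f d ->
  is_derive x v (fun y => Num.sqrt (f y)) (d / (2 * Num.sqrt (f x))).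
Proof.
move=> fx hf; set g := fun h : R => f (x + h *: v).
have g0 : g 0 = f x by rewrite /g scale0r addr0.
have hg : is_derive (0 : R) 1 g d.
  have := @is_derive_line _ _ _ f x v 0; rewrite scale0r addr0.
  by move=> /(_ (@ex_derive _ _ _ _ _ _ _ hf)); rewrite (@derive_val _ _ _ _ _ _ _ hf).
have hs : is_derive (g 0) (1 : R) Num.sqrt (2 * Num.sqrt (g 0))^-1.
  by rewrite g0; exact: is_derive1_sqrt.
have := @is_derive1_comp _ _ _ _ _ _ hs hg; rewrite g0 => -[h1 h2].
have E : (fun h : R => h^-1 *: (((Num.sqrt \o g) \o shift 0) (h *: 1) - (Num.sqrt \o g) 0)) =
  (fun h => h^-1 *: (((fun y => Num.sqrt (f y)) \o shift x) (h *: v) - Num.sqrt (f x))).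
  by apply/funext => h /=; rewrite g0 /g [h *: 1]mulr1 addr0 [x + _]addrC.
move: h1 h2; rewrite /derivable /derive E => h1 h2.
by apply: DeriveDef => //; rewrite /derive h2 mulrC.
Qed.

(** The generator of the rotations in the plane of [x] and [y]. *)
Definition wedge {R : realType} n (x y : 'cV[R]_n) : 'M[R]_n :=
  x *m y^T - y *m x^T.

Section Wedge.
Context {R : realType}.

Lemma wedgeE n (x y : 'cV[R]_n) i j :
  wedge x y i j = x i 0 * y j 0 - y i 0 * x j 0.
Proof. by rewrite !mxE !big_ord1 !mxE. Qed.

Lemma wedge_skew n (x y : 'cV[R]_n) : skew_mx (wedge x y).
Proof. by rewrite /skew_mx /wedge linearB /= !trmx_mul !trmxK opprB. Qed.

Lemma skew_mxD n (A C : 'M[R]_n) : skew_mx A -> skew_mx C -> skew_mx (A + C).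
Proof. by rewrite /skew_mx => hA hC; rewrite linearD /= hA hC opprD. Qed.

Lemma skew_mxZ n k (A : 'M[R]_n) : skew_mx A -> skew_mx (k *: A).
Proof. by rewrite /skew_mx => hA; rewrite linearZ /= hA scalerN. Qed.

Lemma skew_mxB n (A C : 'M[R]_n) : skew_mx A -> skew_mx C -> skew_mx (A - C).
Proof. by move=> hA hC; rewrite -scaleN1r; apply/skew_mxD/skew_mxZ. Qed.

Lemma dot_wedge n (x y u v : 'cV[R]_n) :
  dot (wedge x y *m u) v = dot y u * dot x v - dot x u * dot y v.
Proof.
have E (z w : 'cV[R]_n) : (z *m w^T) *m u = dot w u *: z.
  by rewrite -mulmxA [w^T *m u]mx11_scalar mul_mx_scalar.
by rewrite /wedge mulmxBl !E dotBl !dotZl.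
Qed.

Lemma is_derive_wedge (V : normedModType R) n (f g : V -> 'cV[R]_n) x v df dg :
  is_derive x v f df -> is_derive x v g dg ->
  is_derive x v (fun y => wedge (f y) (g y)) (wedge df (g x) + wedge (f x) dg).
Proof.
move=> hf hg; apply: is_derive_mx => i j.
apply: (@is_derive_fun _ _ _ (fun y => f y i 0 * g y j 0 - g y i 0 * f y j 0)).
  by move=> y; rewrite wedgeE.
have [fi fj] := (is_derive_entry i 0 hf, is_derive_entry j 0 hf).
have [gi gj] := (is_derive_entry i 0 hg, is_derive_entry j 0 hg).
apply: (is_derive_eq (is_derive_sub (is_derive_mul fi gj) (is_derive_mul gi fj))).
by rewrite mxE !wedgeE; ring.
Qed.

End Wedge.

Section KillingField.
Context {R : realType}.
Let P := 'rV[R]_2.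
Variables (rho N e1 e2 : P -> 'cV[R]_4) (a : P -> R) (W1 W2 : P -> P).
Hypothesis hF : adapted_frame rho N e1 e2 a W1 W2.
Hypothesis a_ge0 : forall y, 0 <= a y.
Variable B : 'M[R]_4.
Hypotheses (skB : skew_mx B) (fB0 : forall y, fB rho N B y = 0).

(** Of the six entries of [B] in the moving frame, [<B rho, N>] vanishes and
    the two not named here are multiples of [v1] and [v2]. *)
Let v1 y := dot (B *m rho y) (e1 y).
Let v2 y := dot (B *m rho y) (e2 y).
Let r y := dot (B *m e1 y) (e2 y).

Lemma killing_1N y : dot (B *m e1 y) (N y) = a y * v1 y.
Proof.
have h := is_derive_dot (is_derive_mulmxl B (af_rho1 hF y)) (af_N1 hF y).
have := is_derive_const_eq0 fB0 h; rewrite dotZr -/(v1 y).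
by move: (dot _ _) => k ?; lra.
Qed.

Lemma killing_2N y : dot (B *m e2 y) (N y) = - (a y * v2 y).
Proof.
have h := is_derive_dot (is_derive_mulmxl B (af_rho2 hF y)) (af_N2 hF y).
have := is_derive_const_eq0 fB0 h; rewrite dotZr -/(v2 y).
by move: (dot _ _) => k ?; lra.
Qed.

(** Constancy of [B] turns the structure equations into differential equations
    for its entries; differentiating [killing_1N] then gives two linear
    relations with the connection form. *)
Lemma killing_equations y : 0 < a y -> exists p q,
  [/\ p * v2 y = q * v1 y, r y = p * v1 y + q * v2 y & forall c1 c2,
  let v := c1 *: W1 y + c2 *: W2 y in let k := c1 * p + c2 * q in
  [/\ is_derive y v rho (c1 *: e1 y + c2 *: e2 y),
      is_derive y v N (- (c1 * a y) *: e1 y + (c2 * a y) *: e2 y),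
      is_derive y v e1 (k *: e2 y - c1 *: rho y + (c1 * a y) *: N y),
      is_derive y v e2 (- k *: e1 y - c2 *: rho y - (c2 * a y) *: N y) &
      is_derive y v a (2 * a y * (c2 * p - c1 * q))] /\
  [/\ is_derive y v v1 (k * v2 y - c2 * r y),
      is_derive y v v2 (c1 * r y - k * v1 y) &
      is_derive y v r ((c2 * v1 y - c1 * v2 y) * (1 - a y ^+ 2))]].
Proof.
move=> a0; have [p [q S]] := structure_equations hF a0.
have f0 : dot (B *m rho y) (N y) = 0 by exact: fB0.
have f0' : dot (B *m N y) (rho y) = 0 by rewrite dot_skew// f0 oppr0.
have b0 x : dot (B *m x) x = 0 by exact: dot_skew0.
have b21 : dot (B *m e2 y) (e1 y) = - r y by rewrite dot_skew.
have b1r : dot (B *m e1 y) (rho y) = - v1 y by rewrite dot_skew.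
have b2r : dot (B *m e2 y) (rho y) = - v2 y by rewrite dot_skew.
have bN1 : dot (B *m N y) (e1 y) = - (a y * v1 y) by rewrite dot_skew// killing_1N.
have bN2 : dot (B *m N y) (e2 y) = a y * v2 y by rewrite dot_skew// killing_2N opprK.
have dv1 c1 c2 (v := c1 *: W1 y + c2 *: W2 y) (k := c1 * p + c2 * q) :
    is_derive y v v1 (k * v2 y - c2 * r y).
  have [hr _ h1 _ _] := S c1 c2.
  apply: (is_derive_eq (is_derive_dot (is_derive_mulmxl B hr) h1)).
  rewrite mulmxDr -!scalemxAr !dot_lin !b0 f0 b21 -/(v2 y) /k.
  by move: (v2 y) (r y) => *; ring.
have dv2 c1 c2 (v := c1 *: W1 y + c2 *: W2 y) (k := c1 * p + c2 * q) :
    is_derive y v v2 (c1 * r y - k * v1 y).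
  have [hr _ _ h2 _] := S c1 c2.
  apply: (is_derive_eq (is_derive_dot (is_derive_mulmxl B hr) h2)).
  rewrite mulmxDr -!scalemxAr !dot_lin !b0 f0 -/(r y) -/(v1 y) /k.
  by move: (v1 y) (r y) => *; ring.
have dr c1 c2 (v := c1 *: W1 y + c2 *: W2 y) :
    is_derive y v r ((c2 * v1 y - c1 * v2 y) * (1 - a y ^+ 2)).
  have [_ _ h1 h2 _] := S c1 c2.
  apply: (is_derive_eq (is_derive_dot (is_derive_mulmxl B h1) h2)).
  rewrite mulmxDr mulmxBr -!scalemxAr !dot_lin !b0 -/(v2 y) bN2 b1r killing_1N.
  by move: (v1 y) (v2 y) (a y) => *; ring.
have rel c1 c2 (k := c1 * p + c2 * q) : 2 * a y * (c2 * p - c1 * q) * v1 y +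
    a y * (k * v2 y - c2 * r y) = - k * a y * v2 y + c2 * a y * r y.
  have [hr hn h1 _ ha] := S c1 c2.
  have h := is_derive_dot (is_derive_mulmxl B h1) hn.
  rewrite -(is_derive_val (is_derive_fun killing_1N h) (is_derive_mul ha (dv1 c1 c2))).
  rewrite mulmxDr mulmxBr -!scalemxAr !dot_lin !b0 f0 killing_2N -/(r y) /k.
  by move: (v2 y) (r y) (a y) => *; ring.
have an0 : a y != 0 by rewrite gt_eqF.
exists p, q; split.
- by apply/(mulfI an0); have /= := rel 1 0; move: (v1 y) (v2 y) (r y) (a y) => *; lra.
- by apply/(mulfI an0); have /= := rel 0 1; move: (v1 y) (v2 y) (r y) (a y) => *; lra.
move=> c1 c2 v k; split; first exact: S.
by split; [exact: dv1 | exact: dv2 | exact: dr].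
Qed.

(** The squared length of the Killing field in the metric [a |d rho|^2], which
    is flat away from the umbilic points. *)
Let energy y := a y * (v1 y ^+ 2 + v2 y ^+ 2).

Lemma v1_derivable y v : derivable v1 y v.
Proof.
by case: (is_derive_dot (is_derive_mulmxl B (gateaux_is_derive v (af_d_rho hF y)))
  (gateaux_is_derive v (af_d_e1 hF y))).
Qed.

Lemma v2_derivable y v : derivable v2 y v.
Proof.
by case: (is_derive_dot (is_derive_mulmxl B (gateaux_is_derive v (af_d_rho hF y)))
  (gateaux_is_derive v (af_d_e2 hF y))).
Qed.

(** At a zero of [a], which is a minimum, both [a] and its derivative vanish. *)
Lemma energy_const y z : energy y = energy z.
Proof.
apply: derive0_const => {}y v.
pose s x := v1 x * v1 x + v2 x * v2 x.
apply: (@is_derive_fun _ _ _ (fun x => a x * s x)) => [x|].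
  by rewrite /s -!expr2.
have [a0|a0] := ltP 0 (a y).
  have [p [q [e1' e2' K]]] := killing_equations a0.
  have [c1 [c2 ->]] := af_span hF v a0.
  have [[_ _ _ _ ha] [h1 h2 _]] := K c1 c2.
  apply: (is_derive_eq (is_derive_mul ha (is_derive_add (is_derive_mul h1 h1)
    (is_derive_mul h2 h2)))).
  rewrite /s e2'; move: e1'; move: (v1 y) (v2 y) (a y) => x1 x2 ay e.
  have -> : 2 * ay * (c2 * p - c1 * q) * (x1 * x1 + x2 * x2) +
    ay * (((c1 * p + c2 * q) * x2 - c2 * (p * x1 + q * x2)) * x1 +
    x1 * ((c1 * p + c2 * q) * x2 - c2 * (p * x1 + q * x2)) +
    ((c1 * (p * x1 + q * x2) - (c1 * p + c2 * q) * x1) * x2 +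
    x2 * (c1 * (p * x1 + q * x2) - (c1 * p + c2 * q) * x1))) =
    (p * x2 - q * x1) * (2 * ay * (c1 * x1 + c2 * x2)) by ring.
  by rewrite e subrr mul0r.
have ay0 : a y = 0 by apply/eqP; rewrite eq_le a0 a_ge0.
have da : is_derive y v a 0.
  apply: derive_at_min => x; last by rewrite ay0.
  exact: gateaux_derivable (af_d_a hF x).
have d1 := derivableP (@v1_derivable y v); have d2 := derivableP (@v2_derivable y v).
apply: (is_derive_eq (is_derive_mul da (is_derive_add (is_derive_mul d1 d1)
  (is_derive_mul d2 d2)))).
by rewrite ay0 !mul0r addr0.
Qed.

(** Away from the umbilic points all the entries of [B] in the orthonormal
    frame are linear combinations of [v1] and [v2]. *)
Lemma killing_eq0 y : 0 < a y -> v1 y = 0 -> v2 y = 0 -> B = 0.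
Proof.
move=> a0 z1 z2; have [p [q [_ rE _]]] := killing_equations a0.
rewrite z1 z2 !mulr0 addr0 in rE.
have n1 : dot (B *m e1 y) (N y) = 0 by rewrite killing_1N z1 mulr0.
have n2 : dot (B *m e2 y) (N y) = 0 by rewrite killing_2N z2 mulr0 oppr0.
have f0 : dot (B *m rho y) (N y) = 0 by exact: fB0.
have ex x : dot (B *m x) (rho y) = 0 -> dot (B *m x) (e1 y) = 0 ->
    dot (B *m x) (e2 y) = 0 -> dot (B *m x) (N y) = 0 -> B *m x = 0.
  move=> x0 x1 x2 x3; rewrite (frame_expand hF (B *m x) a0) x0 x1 x2 x3.
  by rewrite !scale0r !addr0.
have B0 : B *m rho y = 0 by apply: ex => //; exact: dot_skew0.
have B1 : B *m e1 y = 0.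
  by apply: ex => //; rewrite ?dot_skew0// dot_skew// -/(v1 y) z1 oppr0.
have B2 : B *m e2 y = 0.
  by apply: ex => //; rewrite ?dot_skew0// dot_skew// ?B0 ?B1 dot0l oppr0.
have B3 : B *m N y = 0.
  by apply: ex; rewrite ?dot_skew0// dot_skew// ?B0 ?B1 ?B2 dot0l oppr0.
apply/matrixP => i j; rewrite [RHS]mxE.
have := colE j B; rewrite (frame_expand hF (delta_mx j 0) a0).
rewrite !mulmxDr -!scalemxAr B0 B1 B2 B3 !scaler0 !addr0 => /colP/(_ i).
by rewrite !mxE.
Qed.

(** The constant [energy] vanishes at a zero of [a]. If it is zero, a point with
    [a > 0] would have [v1 = v2 = 0] and so [B = 0]. *)
Lemma a_gt0_or_eq0 : B != 0 -> (forall y, a y = 0) \/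
  (forall y, 0 < a y) /\ 0 < energy 0.
Proof.
move=> B0; have [[y ay]|noa] := pselect (exists y, 0 < a y); last first.
  left=> y; apply/eqP; rewrite eq_le a_ge0 andbT leNgt.
  by apply/negP => ay; apply: noa; exists y.
right; have e0 : 0 < energy y.
  rewrite /energy mulr_gt0// lt_def addr_ge0 ?sqr_ge0// andbT.
  apply: contraNneq B0 => /eqP; rewrite paddr_eq0 ?sqr_ge0// !sqrf_eq0.
  by move=> /andP[/eqP z1 /eqP z2]; rewrite (killing_eq0 ay z1 z2).
rewrite (energy_const 0 y); split=> // z; rewrite lt_def a_ge0 andbT.
apply: contraTneq e0 => az.
by rewrite (energy_const y z) /energy az mul0r ltxx.
Qed.

Section NoUmbilic.
Hypothesis a_gt0 : forall y, 0 < a y.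

(** In the moving frame this is the Hodge dual of [B], up to orientation. The
    Hodge dual of a constant matrix is constant, and it exchanges the entries
    [<B e1, e2>] and [<B rho, N>]. *)
Let dual y : 'M[R]_4 := r y *: wedge (N y) (rho y)
  - (a y * v2 y) *: wedge (e1 y) (rho y) - (a y * v1 y) *: wedge (e2 y) (rho y)
  - v2 y *: wedge (N y) (e1 y) + v1 y *: wedge (N y) (e2 y).

(** The structure equations and [killing_equations] turn the derivative into a
    combination of wedges with vanishing coefficients. *)
Lemma dual_const y z : dual y = dual z.
Proof.
apply/matrixP => i j.
apply: (@derive0_const _ _ (fun y => dual y i j)) => {}y v.
suff h : is_derive y v dual 0 by have := is_derive_entry i j h; rewrite mxE.
have a0 := a_gt0 y.
have [p [q [e1' e2' K]]] := killing_equations a0.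
have [c1 [c2 ->]] := af_span hF v a0.
have [[hr hn h1 h2 ha] [d1 d2 dr]] := K c1 c2.
have A := is_derive_scale dr (is_derive_wedge hn hr).
have C := is_derive_scale (is_derive_mul ha d2) (is_derive_wedge h1 hr).
have D := is_derive_scale (is_derive_mul ha d1) (is_derive_wedge h2 hr).
have E := is_derive_scale d2 (is_derive_wedge hn h1).
have F := is_derive_scale d1 (is_derive_wedge hn h2).
apply: (is_derive_eq (is_derive_add (is_derive_sub (is_derive_sub (is_derive_sub A C) D) E) F)).
apply/matrixP => k l; rewrite !(mxE, big_ord1).
move: e1' e2'; move: (v1 y) (v2 y) (r y) (a y) => x1 x2 ry ay.
move: (e1 y k 0) (e1 y l 0) (e2 y k 0) (e2 y l 0) (N y k 0) (N y l 0).
move: (rho y k 0) (rho y l 0) => rk rl ek el fk fl nk nl e ->.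
(* only the wedges of [e1 y] and [e2 y] with [rho y] use [p x2 = q x1] *)
transitivity ((p * x2 - q * x1) *
  (- 2 * ay * (c2 * (ek * rl - rk * el) + c1 * (fk * rl - rk * fl)))).
  by ring.
by rewrite e subrr mul0r.
Qed.

Lemma dual_skew y : skew_mx (dual y).
Proof.
rewrite /dual; apply: skew_mxD; last exact/skew_mxZ/wedge_skew.
do 3!(apply: skew_mxB; last exact/skew_mxZ/wedge_skew).
exact/skew_mxZ/wedge_skew.
Qed.

Lemma fB_dual y : fB rho N (dual 0) y = r y.
Proof.
rewrite (dual_const 0 y) /fB /dual !mulmxDl !mulNmx -!scalemxAl.
rewrite !dot_lin !dot_wedge (af_rho_rho hF) (af_N_N hF) (af_1_rho hF).
rewrite (af_2_rho hF) (af_N_rho hF) (af_1_N hF) (af_2_N hF) (dotC (rho y)) (af_N_rho hF).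
by ring.
Qed.

Lemma sqrt_a_v1_const y z : Num.sqrt (a y) * v1 y = Num.sqrt (a z) * v1 z.
Proof.
apply: (@derive0_const _ _ (fun y => Num.sqrt (a y) * v1 y)) => {}y v.
have a0 := a_gt0 y; have [p [q [e1' e2' K]]] := killing_equations a0.
have [c1 [c2 ->]] := af_span hF v a0.
have [[_ _ _ _ ha] [d1 _ _]] := K c1 c2.
apply: (is_derive_eq (is_derive_mul (is_derive_sqrt a0 ha) d1)).
have s0 : Num.sqrt (a y) != 0 by rewrite gt_eqF// sqrtr_gt0.
rewrite e2' -[X in 2 * X * (_ - _)](sqr_sqrtr (ltW a0)).
move: e1'; move: (v1 y) (v2 y) (Num.sqrt _) s0 => x1 x2 s s0 e.
transitivity ((p * x2 - q * x1) * (s * c1)); first by field.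
by rewrite e subrr mul0r.
Qed.

Lemma sqrt_a_v2_const y z : Num.sqrt (a y) * v2 y = Num.sqrt (a z) * v2 z.
Proof.
apply: (@derive0_const _ _ (fun y => Num.sqrt (a y) * v2 y)) => {}y v.
have a0 := a_gt0 y; have [p [q [e1' e2' K]]] := killing_equations a0.
have [c1 [c2 ->]] := af_span hF v a0.
have [[_ _ _ _ ha] [_ d2 _]] := K c1 c2.
apply: (is_derive_eq (is_derive_mul (is_derive_sqrt a0 ha) d2)).
have s0 : Num.sqrt (a y) != 0 by rewrite gt_eqF// sqrtr_gt0.
rewrite e2' -[X in 2 * X * (_ - _)](sqr_sqrtr (ltW a0)).
move: e1'; move: (v1 y) (v2 y) (Num.sqrt _) s0 => x1 x2 s s0 e.
transitivity ((p * x2 - q * x1) * (s * c2)); first by field.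
by rewrite e subrr mul0r.
Qed.

(** The relations [p v2 = q v1] and [r = p v1 + q v2] give [r v1 = p |v|^2] and
    [r v2 = q |v|^2], where [|v|^2 = energy / a]. As [sqrt a * v_i] is constant,
    the Codazzi equations make [a^{-3/2} W_i(a)] a constant multiple of [r]. *)
Lemma htheta_eq_fB : 0 < energy 0 -> exists2 B1, skew_mx B1 &
  exists k : R -> R, forall theta y,
  htheta a W1 W2 theta y = k theta * fB rho N B1 y.
Proof.
move=> E0; exists (dual 0); first exact: dual_skew.
pose al := Num.sqrt (a 0) * v1 0; pose be := Num.sqrt (a 0) * v2 0.
exists (fun theta => cos theta * (- 2 * be / energy 0) +
  sin theta * (2 * al / energy 0)) => theta y; rewrite fB_dual.
have a0 := a_gt0 y; have [p [q [e1' e2' K]]] := killing_equations a0.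
have [[_ _ _ _ ha1] _] := K 1 0; have [[_ _ _ _ ha2] _] := K 0 1.
rewrite !(scale1r, scale0r, addr0, add0r) in ha1 ha2.
rewrite /htheta (@derive_val _ _ _ _ _ _ _ ha1) (@derive_val _ _ _ _ _ _ _ ha2).
have -> : a y `^ (- (3 / 2)) = (a y * Num.sqrt (a y))^-1.
  have -> : - (3 / 2) = - (1 + 2^-1) :> R by lra.
  rewrite powRN powRD ?gt_eqF ?implybT// powRr1 ?ltW//.
  by rewrite powR12_sqrt ?ltW.
rewrite /al (sqrt_a_v1_const 0 y) /be (sqrt_a_v2_const 0 y).
have En0 : energy y != 0 by rewrite (energy_const y 0) gt_eqF.
rewrite (energy_const 0 y); move: En0; rewrite /energy e2'.
have s0 : Num.sqrt (a y) != 0 by rewrite gt_eqF// sqrtr_gt0.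
rewrite -(sqr_sqrtr (ltW a0)) sqrtr_sqr ger0_norm ?sqrtr_ge0//.
move: e1'; move: (v1 y) (v2 y) (Num.sqrt _) s0 => x1 x2 s s0 e.
rewrite mulf_eq0 negb_or => /andP[_ n0].
have qE : (p * x1 + q * x2) * x2 = q * (x1 ^+ 2 + x2 ^+ 2).
  transitivity (p * x2 * x1 + q * x2 ^+ 2); first by ring.
  by rewrite e; ring.
have pE : (p * x1 + q * x2) * x1 = p * (x1 ^+ 2 + x2 ^+ 2).
  transitivity (p * x1 ^+ 2 + q * x1 * x2); first by ring.
  by rewrite -e; ring.
move: (cos theta) (sin theta) => c d.
transitivity (c * (- 2 / (s * (x1 ^+ 2 + x2 ^+ 2))) * ((p * x1 + q * x2) * x2) +
  d * (2 / (s * (x1 ^+ 2 + x2 ^+ 2))) * ((p * x1 + q * x2) * x1)).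
  by rewrite qE pE; field; rewrite s0 n0.
by field; rewrite s0 n0.
Qed.

End NoUmbilic.

End KillingField.

(** * The principal frame of a minimal torus *)

Section GateauxField.
Context {R : realType}.
Let P := 'rV[R]_2.

Lemma gateaux_field m n (f : P -> 'M[R]_(m, n)) (Y : P -> P) y :
  smooth f -> smooth Y -> gateaux (fun z => 'D_(Y z) f z) y.
Proof.
move=> sf sY; have df := smooth_diff y sf; have dY := smooth_diff y sY.
have dfY := smooth_diff y (smooth_derive (Y y) sf).
exists (fun v => 'D_v ('D_(Y y) f) y + 'D_('D_v Y y) f y); split=> [c c' v v'|v].
  rewrite (deriveDr _ _ dfY) (deriveZr _ _ dfY) (deriveZr _ _ dfY).
  rewrite (deriveDr _ _ dY) (deriveZr _ _ dY) (deriveZr _ _ dY).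
  rewrite (deriveDr _ _ df) (deriveZr _ _ df) (deriveZr _ _ df).
  by rewrite !scalerDr addrACA.
exact: is_derive_field sf (derivableP (smooth_derivable y v sY)).
Qed.

Lemma gateaux_dot (V : normedModType R) n (f g : V -> 'cV[R]_n) x :
  gateaux f x -> gateaux g x -> gateaux (fun y => dot (f y) (g y)) x.
Proof.
move=> [k [kl hk]] [l [ll hl]].
exists (fun v => dot (k v) (g x) + dot (f x) (l v)); split=> [c c' v v'|v].
  by rewrite kl ll !dot_lin /GRing.scale /=; ring.
exact: is_derive_dot.
Qed.

(** The second derivatives cancel in a commutator, leaving the derivative along
    the bracket. *)
Lemma bracket_derivative m n (f : P -> 'M[R]_(m, n)) (X Y : P -> P) y dXY dYX :
  smooth f -> smooth X -> smooth Y ->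
  is_derive y (X y) (fun z => 'D_(Y z) f z) dXY ->
  is_derive y (Y y) (fun z => 'D_(X z) f z) dYX ->
  dXY - dYX = 'D_('D_(X y) Y y - 'D_(Y y) X y) f y.
Proof.
move=> sf sX sY hXY hYX; have df := smooth_diff y sf.
have h1 := is_derive_field sf (derivableP (smooth_derivable y (X y) sY)).
have h2 := is_derive_field sf (derivableP (smooth_derivable y (Y y) sX)).
rewrite (is_derive_val hXY h1) (is_derive_val hYX h2).
rewrite (smooth_derive_sym y (Y y) (X y) sf) opprD addrACA subrr add0r.
by rewrite -scaleN1r -[in RHS]scaleN1r (deriveDr _ _ df) (deriveZr _ _ df).
Qed.

End GateauxField.

Section PrincipalFrame.
Context {R : realType}.
Let P := 'rV[R]_2.
Variables (rho N : P -> 'cV[R]_4) (a : P -> R) (W1 W2 : P -> P).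
Hypotheses (hrho : immersion_S3 rho) (hN : gauss_map rho N).
Hypothesis hW : principal_frame rho N a W1 W2.

Let sr : smooth rho. Proof. by case: hrho. Qed.
Let sN : smooth N. Proof. by case: hN. Qed.
Let sW1 : smooth W1. Proof. by case: hW => -[]. Qed.
Let sW2 : smooth W2. Proof. by case: hW => _ []. Qed.

Lemma dot_derive_rho v y : dot ('D_v rho y) (rho y) = 0.
Proof. by rewrite dotC (deriveE v (smooth_diff y sr)); exact: dot_rho_tangent. Qed.

Lemma dot_derive_N v y : dot ('D_v rho y) (N y) = 0.
Proof. by rewrite dotC (deriveE v (smooth_diff y sr)); case: hN. Qed.

Lemma frame1_unit y : dot ('D_(W1 y) rho y) ('D_(W1 y) rho y) = 1.
Proof. by rewrite (deriveE _ (smooth_diff y sr)); case: hW => -[]. Qed.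

Lemma frame2_unit y : dot ('D_(W2 y) rho y) ('D_(W2 y) rho y) = 1.
Proof. by rewrite (deriveE _ (smooth_diff y sr)); case: hW => _ []. Qed.

Lemma derive_N1 y : 'D_(W1 y) N y = - a y *: 'D_(W1 y) rho y.
Proof.
rewrite (deriveE _ (smooth_diff y sr)) (deriveE _ (smooth_diff y sN)).
by case: hW.
Qed.

Lemma derive_N2 y : 'D_(W2 y) N y = a y *: 'D_(W2 y) rho y.
Proof.
rewrite (deriveE _ (smooth_diff y sr)) (deriveE _ (smooth_diff y sN)).
by case: hW.
Qed.

(** Self-adjointness of the shape operator: both sides are
    [- <N, D_v D_w rho>]. *)
Lemma second_form_sym v w y :
  dot ('D_v N y) ('D_w rho y) = dot ('D_w N y) ('D_v rho y).
Proof.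
have H u u' : dot ('D_u N y) ('D_u' rho y) = - dot (N y) ('D_u ('D_u' rho) y).
  have z y' : dot (N y') ('D_u' rho y') = 0 by rewrite dotC dot_derive_N.
  exact: dot_const_derive z (derivableP (smooth_derivable y u sN))
    (derivableP (smooth_derivable y u (smooth_derive u' sr))).
by rewrite (H v w) (H w v) (smooth_derive_sym y v w sr).
Qed.

Lemma a_dot_frame y : a y * dot ('D_(W1 y) rho y) ('D_(W2 y) rho y) = 0.
Proof.
have := second_form_sym (W1 y) (W2 y) y; move: (derive_N1 y) (derive_N2 y).
move: ('D_(W1 y) N y) ('D_(W2 y) N y) ('D_(W1 y) rho y) ('D_(W2 y) rho y).
by move=> n1 n2 r1 r2 -> ->; rewrite !dotZl (dotC r2); lra.
Qed.

(** By the formula [a = - <dN (W1), d rho (W1)>]. *)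
Lemma a_gateaux y : gateaux a y.
Proof.
have [l [hl h]] := gateaux_dot (gateaux_field y sN sW1) (gateaux_field y sr sW1).
have e z : - dot ('D_(W1 z) N z) ('D_(W1 z) rho z) = a z.
  by rewrite derive_N1 dotZl frame1_unit mulr1 opprK.
exists (fun v => - l v); split=> [c c' v v'|v].
  by rewrite hl opprD !scalerN.
exact: is_derive_fun e (is_derive_opp (h v)).
Qed.

Lemma frame_span y v : 0 < a y -> exists c1 c2, v = c1 *: W1 y + c2 *: W2 y.
Proof.
move=> a0; have [_ _ r1 inj] := hrho; have dr := smooth_diff y sr.
exists (dot ('D_v rho y) ('D_(W1 y) rho y)), (dot ('D_v rho y) ('D_(W2 y) rho y)).
apply: (inj y); rewrite -(deriveE v dr) -(deriveE _ dr).
rewrite (deriveDr _ _ dr) (deriveZr _ _ dr) (deriveZr _ _ dr).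
have o12 : dot ('D_(W1 y) rho y) ('D_(W2 y) rho y) = 0.
  by have /eqP := a_dot_frame y; rewrite mulf_eq0 (gt_eqF a0) /= => /eqP.
move: (frame1_unit y) (frame2_unit y) (dot_derive_rho v y) (dot_derive_N v y).
move: (dot_derive_rho (W1 y) y) (dot_derive_rho (W2 y) y) o12.
move: (dot_derive_N (W1 y) y) (dot_derive_N (W2 y) y).
move: ('D_v rho y) ('D_(W1 y) rho y) ('D_(W2 y) rho y) => u u1 u2.
move=> n1 n2 r1' r2' o12 u11 u22 ur un.
have [_ _ N1 Nr _] := hN.
rewrite [LHS](@orthonormal_expand _ (rho y) u1 u2 (N y)).
- by rewrite ur un !scale0r add0r addr0.
- by split; [exact: r1 | | | exact: N1].
- by split; rewrite dotC ?r1' ?r2' ?Nr.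
- by split.
Qed.

Lemma principal_adapted_frame : adapted_frame rho N
  (fun y => 'D_(W1 y) rho y) (fun y => 'D_(W2 y) rho y) a W1 W2.
Proof.
have [_ _ r1 _] := hrho; have [_ _ N1 Nr _] := hN.
split=> //.
- exact: frame1_unit.
- exact: frame2_unit.
- by move=> y; exact: dot_derive_rho.
- by move=> y; exact: dot_derive_rho.
- by move=> y; exact: dot_derive_N.
- by move=> y; exact: dot_derive_N.
- exact: a_dot_frame.
- by move=> y; exact: derivableP (smooth_derivable y _ sr).
- by move=> y; exact: derivableP (smooth_derivable y _ sr).
- by move=> y; rewrite -derive_N1; exact: derivableP (smooth_derivable y _ sN).
- by move=> y; rewrite -derive_N2; exact: derivableP (smooth_derivable y _ sN).
- by move=> y; exact: gateaux_diff (smooth_diff y sr).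
- by move=> y; exact: gateaux_diff (smooth_diff y sN).
- by move=> y; exact: gateaux_field.
- by move=> y; exact: gateaux_field.
- exact: a_gateaux.
- exact: frame_span.
move=> y x12 x21 d1 d2 h12 h21 hd1 hd2 z.
pose Z := 'D_(W1 y) W2 y - 'D_(W2 y) W1 y.
have rZ : x12 - x21 = 'D_Z rho y := bracket_derivative sr sW1 sW2 h12 h21.
have k12 := is_derive_fun (fun z => esym (derive_N2 z)) (is_derive_scale hd1 h12).
have k21 := is_derive_fun (fun z => esym (derive_N1 z))
  (is_derive_scale (is_derive_opp hd2) h21).
have NZ := bracket_derivative sN sW1 sW2 k12 k21.
have zZ : z = 'D_Z N y.
  by rewrite -NZ /z !scaleNr opprD !opprK.
rewrite zZ rZ; move: (second_form_sym Z (W1 y) y) (second_form_sym Z (W2 y) y).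
move: (derive_N1 y) (derive_N2 y).
move: ('D_Z N y) ('D_Z rho y) ('D_(W1 y) N y) ('D_(W2 y) N y).
move: ('D_(W1 y) rho y) ('D_(W2 y) rho y) => u1 u2 dN dr n1 n2 -> -> -> ->.
by rewrite !dotZl (dotC dr u1) (dotC dr u2).
Qed.

End PrincipalFrame.

(** * Hsiang-Lawson tori and the natural nullity *)

(** If [a] vanishes identically the functions [h_theta] are zero; otherwise they
    are functions [f_B]. In both cases [NS] consists of functions [f_B]. *)
Lemma hsiang_lawson_nnt_le5 (R : realType) (rho N : 'rV[R]_2 -> 'cV[R]_4)
    (a : 'rV[R]_2 -> R) (W1 W2 : 'rV[R]_2 -> 'rV[R]_2) :
  immersion_S3 rho -> gauss_map rho N -> (forall y, 0 <= a y) ->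
  principal_frame rho N a W1 W2 -> hsiang_lawson rho ->
  (nnt rho N a W1 W2 <= 5%:E)%E.
Proof.
move=> hrho hN a_ge0 hW [B [skB B0 inv]].
have f0 m : fB rho N B m = 0.
  by apply: (invariant_range_fB_eq0 hrho hN skB) => t; rewrite inv.
apply: (nnt_le5 skB B0 f0) => g [B' [lam [theta [skB' ->]]]].
have hF := principal_adapted_frame hrho hN hW.
have [az|[a0 E0]] := a_gt0_or_eq0 hF a_ge0 skB f0 B0.
  exists B' => //; apply/funext => m.
  have da v := is_derive_const_eq0 az (gateaux_is_derive v (af_d_a hF m)).
  by rewrite /htheta !da !mulr0 addr0 mulr0 addr0.
have [B1 skB1 [k hk]] := htheta_eq_fB hF a_ge0 skB f0 a0 E0.
exists (B' + (lam * k theta) *: B1); first exact/skew_mxD/skew_mxZ.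
apply/funext => m; rewrite hk /fB mulmxDl -scalemxAl dotDl dotZl.
by rewrite mulrA.
Qed.

Unset Implicit Arguments.

Theorem corollary5p8 (R : realType)
  (rho N : 'rV[R]_2 -> 'cV[R]_4)
  (a : 'rV[R]_2 -> R) (W1 W2 : 'rV[R]_2 -> 'rV[R]_2)
  (hrho : minimal_immersion rho N)
  (ha : nonneg_principal_curvature rho N a)
  (hW : principal_frame rho N a W1 W2) :
  (nnt rho N a W1 W2 <= 5%:E)%E <-> hsiang_lawson rho.
Proof.
have [him hN _] := hrho.
split; first exact: nnt_le5_hsiang_lawson.
by apply: hsiang_lawson_nnt_le5 => // y; have [] := ha y.
Qed.
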